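(* For the system $$\dot R_i=K_i-f_i(p(q))R_i-\alpha(q)R_i\quad(i=1,\dots,n),\qquad\dot q=\alpha(q)\sum_{i=1}^nR_i-\mu(q)$$ the fixed point $(R^s,q^s)$, characterized by $p'(q^s)>0$, is locally asymptotically stable.
   Context: Write $\mathbb{R}_+=[0,\infty)$; the system is considered on $\mathbb{R}_+^{n+1}$. Let $n\ge1$ be an integer and fix constants $K_1,\dots,K_n,\mu^*,q_c,\beta,q_m>0$. Price function: $p(q)=\beta q$ for $0\le q\le q_m$, $p(q)=\beta(2q_m-q)$ for $q_m\le q\le2q_m$, $p(q)=0$ for $q>2q_m$. Service rate: $\mu(q)=\frac{\mu^*}{q_c}q$ for $0\le q\le q_c$, $\mu(q)=\mu^*$ for $q\ge q_c$. Admission rate: $\alpha:\mathbb{R}_+\to\mathbb{R}_+$ is continuously differentiable and nonincreasing with $\alpha(0)>0$. Price responses: $f_i:\mathbb{R}_+\to\mathbb{R}_+$, $i=1,\dots,n$, are nondecreasing and continuously differentiable, and at least one of them has strictly positive derivative (some may be identically $0$). Let $g(q)=\sum_{i=1}^n\frac{K_i}{f_i(p(q))+\alpha(q)}-\frac{\mu(q)}{\alpha(q)}$ on $\{q\ge0:\alpha(q)>0\}$. Assume $g$ has exactly two zeros $q^s,q^u$, with $0<q^s<q_m<q^u<2q_m$, that $g$ changes sign at each of them, and that $g$ is differentiable at $q^u$ with $$g'(q^u)=-\sum_{i=1}^n\frac{K_i((f_i\circ p)'(q^u)+\alpha'(q^u))}{(f_i(p(q^u))+\alpha(q^u))^2}-\frac{\mu'(q^u)\alpha(q^u)-\mu(q^u)\alpha'(q^u)}{\alpha(q^u)^2}>0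 .$$ Each zero $q^*\in\{q^s,q^u\}$ of $g$ gives the fixed point $(R^*,q^* )$ with $R_i^*=\frac{K_i}{f_i(p(q^* ))+\alpha(q^* )}$; $(R^s,q^s)$ is the one for $q^s$. *)

(* Defs.v *)
From mathcomp Require Import all_boot all_order all_algebra.
From mathcomp Require Import all_classical all_reals all_analysis.
Set Implicit Arguments.
Unset Strict Implicit.
Unset Printing Implicit Defensive.
Import Order.TTheory GRing.Theory Num.Theory.
Import numFieldNormedType.Exports.
Local Open Scope classical_set_scope.
Local Open Scope ring_scope.

(* Derivative relative to a set: one-sided at an endpoint of an interval [A],
   the usual derivative at an interior point. *)
Definition has_derive_within (R : realType) (V : normedModType R)
    (A : set R) (f : R -> V) (t : R) (l : V) : Prop :=
  (s - t)^-1 *: (f s - f t) @[s --> within A t^'] --> l.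

(* Functions on [0, +oo[ are represented by total functions; their values at
   negative reals are unconstrained and never matter. *)
Definition C1_nonneg (R : realType) (f : R -> R) : Prop :=
  exists2 f' : R -> R,
    forall x : R, 0 <= x -> has_derive_within `[0, +oo[ f x (f' x) &
    {within `[0, +oo[, continuous f'}.

Section Autonomous.
Context (R : realType) (V : normedModType R).
Variables (D : set V) (F : V -> V).

(* [x] solves x' = F x on the time interval [I], within the state space [D]. *)
Definition solution_on (I : set R) (x : R -> V) : Prop :=
  forall t, I t -> D (x t) /\ has_derive_within I x t (F (x t)).

Definition fixed_point (xs : V) : Prop := D xs /\ F xs = 0.

(* Forward existence of solutions near [xs] is part of stability, so the bound
   is not vacuous. The bound holds for every solution, including those only
   known on a bounded time interval. *)
Definition stable (xs : V) : Prop :=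
  forall eps : R, 0 < eps -> exists2 delta : R, 0 < delta &
    forall x0 : V, D x0 -> `|x0 - xs| < delta ->
      (exists2 x : R -> V, x 0 = x0 & solution_on `[0, +oo[ x) /\
      (forall (T : R) (x : R -> V), 0 < T -> x 0 = x0 ->
         solution_on `[0, T[ x ->
         forall t : R, 0 <= t < T -> `|x t - xs| < eps).

Definition locally_attractive (xs : V) : Prop :=
  exists2 delta : R, 0 < delta &
    forall x : R -> V, solution_on `[0, +oo[ x -> `|x 0 - xs| < delta ->
      x t @[t --> +oo] --> xs.

Definition locally_asymptotically_stable (xs : V) : Prop :=
  [/\ fixed_point xs, stable xs & locally_attractive xs].

End Autonomous.

Section Model.
Context (R : realType).

Definition price (beta qm q : R) : R :=
  if q <= qm then beta * q
  else if q <= 2 * qm then beta * (2 * qm - q) else 0.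

Definition service (mustar qc q : R) : R :=
  if q <= qc then mustar / qc * q else mustar.

Variables (n : nat) (K : 'I_n -> R) (f : 'I_n -> R -> R).
Variables (p alpha mu : R -> R).

Definition gfun (q : R) : R :=
  (\sum_(i < n) K i / (f i (p q) + alpha q)) - mu q / alpha q.

Definition g_zero (q : R) : Prop := [/\ 0 <= q, 0 < alpha q & gfun q = 0].

(* The expression for g' obtained by differentiating term by term. *)
Definition gfun' (q : R) : R :=
  - (\sum_(i < n) K i * (derive1 (f i \o p) q + derive1 alpha q)
                  / (f i (p q) + alpha q) ^+ 2)
  - (derive1 mu q * alpha q - mu q * derive1 alpha q) / alpha q ^+ 2.

(* A state is the pair ((R_1, ..., R_n), q). *)
Definition state_space : set ('rV[R]_n * R) :=
  [set x : 'rV[R]_n * R | (forall i, 0 <= x.1 0 i) /\ 0 <= x.2].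

Definition vector_field (x : 'rV[R]_n * R) : 'rV[R]_n * R :=
  (\row_(i < n) (K i - f i (p x.2) * x.1 0 i - alpha x.2 * x.1 0 i),
   alpha x.2 * (\sum_(i < n) x.1 0 i) - mu x.2).

Definition fixed_state (q : R) : 'rV[R]_n * R :=
  (\row_(i < n) (K i / (f i (p q) + alpha q)), q).

End Model.

Definition changes_sign_at (R : realType) (g : R -> R) (z : R) : Prop :=
  ((\forall y \near z^'-, 0 < g y) /\ (\forall y \near z^'+, g y < 0)) \/
  ((\forall y \near z^'-, g y < 0) /\ (\forall y \near z^'+, 0 < g y)).

(* Main.v *)
(* Write R_i = R_i^s + r_i, q = q^s + y and let -c (c >= 0) and d_i >= 0 be the
   derivatives of alpha and of f_i o p at q^s, with d_i0 > 0 because p' > 0 there.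
   In terms of secant slopes the system is exactly
     r_i' = - b_i r_i - (d_i - c) R_i^s y,
     y' = alpha sum_i r_i - c y sum_i R_i^s - m y,   0 <= m <= mu^*/q_c,
   with coefficients that tend to their values at q^s, except that m only stays
   bounded since the service rate may have its kink at q^s. A quadratic form
     y^2/2 + sum_i w_i r_i^2/2 + e y r_i0
   decreases along all these linear systems, hence along the nonlinear one near
   the fixed point. Forward solutions are obtained by Picard iteration for a
   field clamped to a box around the fixed point, which they never leave. *)
Require Import Defs.
From mathcomp Require Import all_boot all_order all_algebra.
From mathcomp Require Import all_classical all_reals all_analysis.
From mathcomp Require Import ring lra.
Set Implicit Arguments.
Unset Strict Implicit.
Unset Printing Implicit Defensive.
Import Order.TTheory GRing.Theory Num.Theory.
Import numFieldNormedType.Exports.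
Local Open Scope classical_set_scope.
Local Open Scope ring_scope.

(** * A quadratic Lyapunov function *)

(** Secant slopes leave no remainder term, and changing the other coefficients by at most h costs at
    most a constant times h |(r, y)|^2, which half of the decay rate absorbs. The price feedback
    through [i0] is the only mechanism guaranteed to restore y: c, m and the remaining d_i may all
    vanish, and this dictates the choice of weights. Since stability includes existence of solutions
    for all forward time, trapping is proved for any field that agrees with the true one near the
    fixed point; it then applies both to given solutions and to the constructed ones. *)

Lemma fin_pos_lower_bound (R : realFieldType) (n : nat) (w : 'I_n -> R) :
  (forall i, 0 < w i) -> exists2 k : R, 0 < k & forall i, k <= w i.
Proof.
elim: n w => [|n IH] w w0; first by exists 1 => // -[].
have [k k0 kw] := IH (fun i => w (lift ord0 i)) (fun i => w0 _).
exists (Num.min k (w ord0)); first by rewrite lt_min k0 w0.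
move=> i; rewrite ge_min; case: (unliftP ord0 i) => [j ->|->].
  by rewrite kw.
by rewrite lexx orbT.
Qed.

Section Lyapunov.
Context (R : realFieldType) (n : nat) (i0 : 'I_n).

Definition lyap (w : 'I_n -> R) (e : R) (r : 'I_n -> R) (y : R) : R :=
  y ^+ 2 / 2 + \sum_i w i * r i ^+ 2 / 2 + e * (y * r i0).

(** The derivative of [lyap] along a motion with velocity (r', y'). The velocity is a separate
    argument, so that different fields can be compared algebraically before any curve is present. *)
Definition dlyap (w : 'I_n -> R) (e : R) (r : 'I_n -> R) (y : R)
    (r' : 'I_n -> R) (y' : R) : R :=
  y * y' + \sum_i w i * (r i * r' i) + e * (y' * r i0 + y * r' i0).

Definition sqn (r : 'I_n -> R) (y : R) : R := y ^+ 2 + \sum_i r i ^+ 2.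

Lemma sqn_ge_y (r : 'I_n -> R) y : y ^+ 2 <= sqn r y.
Proof. by rewrite lerDl; apply: sumr_ge0 => i _; rewrite sqr_ge0. Qed.

Lemma sqn_ge_r (r : 'I_n -> R) y i : r i ^+ 2 <= sqn r y.
Proof.
rewrite /sqn (bigD1 i)//= addrCA lerDl addr_ge0 ?sqr_ge0//.
by apply: sumr_ge0 => j _; rewrite sqr_ge0.
Qed.

Lemma sqn_ge0 (r : 'I_n -> R) y : 0 <= sqn r y.
Proof. exact: le_trans (sqr_ge0 _) (sqn_ge_y r y). Qed.

(** The square (y/2 + e r_i0)^2 absorbs the cross term at the price of y^2/4 and e^2 r_i0^2 <= w_i0
    r_i0^2/4, that is, half of each diagonal term involved. *)
Lemma lyap_ge w e : (forall i, 0 < w i) -> 4 * e ^+ 2 <= w i0 ->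
  exists2 k : R, 0 < k & forall r y, k * sqn r y <= lyap w e r y.
Proof.
move=> w0 he; have [k k0 kw] := fin_pos_lower_bound w0.
exists (Num.min (1 / 4) (k / 4)); first by rewrite lt_min; apply/andP; split; lra.
set k' := Num.min _ _ => r y.
have k'1 : k' <= 1 / 4 by rewrite ge_min lexx.
have k'k i : k' <= w i / 4.
  by rewrite ge_min; apply/orP; right; have := kw i; lra.
rewrite /sqn /lyap (bigD1 i0)//= [X in _ <= _ + X + _](bigD1 i0)//=.
have h : k' * (\sum_(i < n | i != i0) r i ^+ 2) <=
         \sum_(i < n | i != i0) w i * r i ^+ 2 / 2.
  rewrite mulr_sumr; apply: ler_sum => i _.
  have := sqr_ge0 (r i); have := k'k i; have := w0 i; nra.
have h1 : k' * y ^+ 2 <= y ^+ 2 / 4 by have := sqr_ge0 y; nra.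
have h2 : k' * r i0 ^+ 2 <= w i0 * r i0 ^+ 2 / 4.
  have := sqr_ge0 (r i0); have := k'k i0; nra.
have h3 : e ^+ 2 * r i0 ^+ 2 <= w i0 * r i0 ^+ 2 / 4.
  have := sqr_ge0 (r i0); nra.
have h4 : 0 <= (y / 2 + e * r i0) ^+ 2 by exact: sqr_ge0.
have h5 : (y / 2 + e * r i0) ^+ 2 =
  y ^+ 2 / 4 + e * (y * r i0) + e ^+ 2 * r i0 ^+ 2 by field.
nra.
Qed.

(** A large r_i can hide in the square k_i r_i - c y only if y is large too, and then A y^2 detects
    it. *)
Lemma sum_quad_ge (c A : R) (B k : 'I_n -> R) :
  0 < A -> (forall i, 0 < B i) -> (forall i, 0 < k i) ->
  exists2 h : R, 0 < h & forall r y,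
    h * sqn r y <= A * y ^+ 2 + \sum_i B i * (k i * r i - c * y) ^+ 2.
Proof.
move=> A0 B0 k0.
have n0 : 0 < n%:R :> R by rewrite ltr0n; case: n i0 => [[]|].
(* Half of A y^2 is shared equally among the n coordinates, each share helping to bound one r_i; the
   other half bounds y itself. *)
pose a := A / (2 * n%:R).
have a0 : 0 < a by apply: divr_gt0 => //; lra.
have [b b0 hb] := fin_pos_lower_bound B0.
have [l l0 hl] := fin_pos_lower_bound k0.
pose D := a + b * c ^+ 2.
have D0 : 0 < D by have := sqr_ge0 c; rewrite /D; nra.
pose h := a * b * l ^+ 2 / D.
have h0 : 0 < h by rewrite !(mulr_gt0, exprn_gt0, invr_gt0).
(* Cauchy-Schwarz in the form a b (u + c y)^2 <= (a + b c^2) (b u^2 + a y^2) *)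
have key u y : h * u ^+ 2 <= l ^+ 2 * (a * y ^+ 2 + b * (u - c * y) ^+ 2).
  rewrite /h mulrAC ler_pdivrMr//.
  have H := sqr_ge0 (a * y - b * c * (u - c * y)).
  have -> : a * b * l ^+ 2 * u ^+ 2 = l ^+ 2 * (a * b * u ^+ 2) by ring.
  rewrite -[leRHS]mulrA ler_pM2l ?exprn_gt0// /D.
  have : (a * y ^+ 2 + b * (u - c * y) ^+ 2) * (a + b * c ^+ 2) =
     (a * y - b * c * (u - c * y)) ^+ 2 + a * b * u ^+ 2 by ring.
  lra.
exists (Num.min h (A / 2)); first by rewrite lt_min h0; lra.
set h' := Num.min _ _ => r y.
have h'h : h' <= h by rewrite ge_min lexx.
have h'A : h' <= A / 2 by rewrite ge_min lexx orbT.
have h'0 : 0 < h' by rewrite lt_min h0; lra.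
have H i : h' * r i ^+ 2 <= a * y ^+ 2 + B i * (k i * r i - c * y) ^+ 2.
  have := key (k i * r i) y; rewrite exprMn => H1.
  have H2 : l ^+ 2 * r i ^+ 2 <= k i ^+ 2 * r i ^+ 2.
    by apply: ler_wpM2r; [exact: sqr_ge0|by rewrite ler_sqr ?nnegrE ?(ltW l0) ?(ltW (k0 i)) ?hl].
  have : l ^+ 2 * (h' * r i ^+ 2) <=
      l ^+ 2 * (a * y ^+ 2 + b * (k i * r i - c * y) ^+ 2).
    apply: le_trans H1; apply: (@le_trans _ _ (h' * (k i ^+ 2 * r i ^+ 2))).
      by rewrite mulrCA ler_pM2l.
    by apply: ler_wpM2r => //; rewrite mulr_ge0// sqr_ge0.
  rewrite ler_pM2l ?exprn_gt0// => /le_trans; apply.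
  by rewrite lerD2l ler_wpM2r ?sqr_ge0.
have : h' * (\sum_i r i ^+ 2) <=
  \sum_(i < n) (a * y ^+ 2 + B i * (k i * r i - c * y) ^+ 2).
  by rewrite mulr_sumr; apply: ler_sum => i _; exact: H.
rewrite big_split/= sumr_const card_ord -mulr_natr.
have -> : a * y ^+ 2 * n%:R = A / 2 * y ^+ 2 by rewrite /a; field; rewrite gt_eqF.
have := sqr_ge0 y; rewrite /sqn; nra.
Qed.

(* For c > 0, e = 0 and w_i = al / ((d_i + c) s_i) turn the derivative into
   - m y^2 - sum_i s_i / (d_i + c) ((al r_i / s_i - c y)^2 + c d_i y^2) up to a
   negative term. For c = 0 that form does not control y, and a small multiple e
   of y r_i0 supplies the missing - e d_i0 s_i0 y^2; the w_i with d_i = 0 are then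
   taken large. *)
Lemma lyapunov_linear (al c L : R) (b d s : 'I_n -> R) :
  0 < al -> 0 <= c -> 0 <= L -> (forall i, al <= b i) -> (forall i, 0 <= d i) ->
  0 < d i0 -> (forall i, 0 < s i) ->
  exists w : 'I_n -> R, exists e : R, exists2 k : R, 0 < k &
   (forall r y, k * sqn r y <= lyap w e r y) /\
   forall m r y, 0 <= m <= L ->
     dlyap w e r y (fun i => - b i * r i - (d i - c) * s i * y)
       (al * (\sum_i r i) - c * (\sum_i s i) * y - m * y) <= - k * sqn r y.
Proof.
move=> al0; rewrite le_eqVlt => /orP[/eqP<-|c0] L0 hb hd d00 s0; last first.
  have dc0 i : 0 < d i + c by have := hd i; lra.
  pose w i := al / ((d i + c) * s i).
  have w0 i : 0 < w i by rewrite divr_gt0// mulr_gt0.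
  have [k1 k10 hk1] := @lyap_ge w 0 w0 ltac:(by rewrite expr0n/= mulr0 ltW).
  pose B i := s i / (d i + c).
  have B0 i : 0 < B i by rewrite divr_gt0.
  (* The coefficient of y^2 left over by index [i0] after completing squares; it is positive because
     c and d_i0 both are. *)
  have A0 : 0 < B i0 * c * d i0 by apply/mulr_gt0 => //; apply/mulr_gt0.
  have [k2 k20 hk2] := @sum_quad_ge c _ B (fun i => al / s i) A0 B0
    (fun i => divr_gt0 al0 (s0 i)).
  exists w, 0, (Num.min k1 k2); first by rewrite lt_min k10 k20.
  split=> [r y|m r y /andP[m0 _]].
    by apply: le_trans (hk1 r y); rewrite ler_wpM2r ?sqn_ge0// ge_min lexx.
  rewrite mulNr lerNr; apply: (@le_trans _ _ (k2 * sqn r y)).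
    by rewrite ler_wpM2r ?sqn_ge0// ge_min lexx orbT.
  apply: le_trans (hk2 r y) _; rewrite /dlyap mul0r addr0.
  rewrite (_ : y * _ = al * (\sum_i r i) * y - (\sum_i s i) * (c * y ^+ 2) - m * y ^+ 2);
    last by ring.
  rewrite mulr_sumr !mulr_suml.
  (* Using al <= b_i and completing the square. Summed over i, the terms s_i c y^2 and al r_i y
     cancel those of y y', leaving only squares and -m y^2. *)
  have H i : w i * (r i * (- b i * r i - (d i - c) * s i * y)) <=
      s i * (c * y ^+ 2) - al * r i * y
      - (B i * (al / s i * r i - c * y) ^+ 2 + B i * c * d i * y ^+ 2).
    have h : w i * (al * r i ^+ 2) <= w i * (b i * r i ^+ 2).
      by rewrite ler_pM2l// ler_wpM2r// sqr_ge0.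
    have h1 : w i * (r i * (- al * r i - (d i - c) * s i * y)) =
      s i * (c * y ^+ 2) - al * r i * y
      - (B i * (al / s i * r i - c * y) ^+ 2 + B i * c * d i * y ^+ 2).
      rewrite /w /B; field; rewrite ?gt_eqF//.
    rewrite -h1; nra.
  have /ler_sum := fun i (_ : true) => H i => /(_ (index_enum _)).
  rewrite !sumrB big_split/=.
  have : B i0 * c * d i0 * y ^+ 2 <= \sum_i B i * c * d i * y ^+ 2.
    rewrite (bigD1 i0)//= lerDl; apply: sumr_ge0 => i _.
    by apply: mulr_ge0; rewrite ?sqr_ge0//; apply: mulr_ge0 => //; apply: mulr_ge0; exact: ltW.
  have : 0 <= m * y ^+ 2 by rewrite mulr_ge0// sqr_ge0.
  lra.

have n0 : 0 < n%:R :> R by rewrite ltr0n; case: n i0 => [[]|].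
have b0 i : 0 < b i by apply: lt_le_trans (hb i).
pose g := d i0 * s i0; have g0 : 0 < g by rewrite mulr_gt0.
(* The three terms are the r_i0^2 costs, in units of e, of the estimates [H3], [H2] and [H4] below.
   [C1] adds al/2 for the rest of [H2], and 1 for the decay that must survive. *)
pose C0 := L / 4 + n%:R * al / 2 + b i0 ^+ 2 / g.
have C00 : 0 <= C0.
  by rewrite !addr_ge0// ?divr_ge0// ?mulr_ge0// ?sqr_ge0// ltW.
pose C1 := al / 2 + C0 + 1.
have C10 : 0 < C1 by rewrite /C1; lra.
(* For d_i > 0 this is the damping b_i w_i of r_i^2, which limits e. For d_i = 0 the weight is
   chosen after e, and 1 is a placeholder. *)
pose u i := if d i == 0 then 1 else b i * (al / (d i * s i)).
have u0 i : 0 < u i.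
  rewrite /u; case: eqVneq => // di.
  by rewrite mulr_gt0// divr_gt0// mulr_gt0// lt_neqAle eq_sym di hd.
have [l l0 hl] := fin_pos_lower_bound u0.
(* The bound 1 gives e m <= L in [H3]; together with al / (4 g) it gives 4 e^2 <= w_i0 for
   positivity; l / C1 keeps the r_i^2 costs below the damping. *)
pose e := Num.min 1 (Num.min (al / (4 * g)) (l / C1)).
have e0 : 0 < e by rewrite !lt_min ltr01 !divr_gt0// mulr_gt0.
have e1 : e <= 1 by rewrite ge_min lexx.
have eg : e <= al / (4 * g) by rewrite !ge_min lexx !orbT.
have el : e * C1 <= l by rewrite -ler_pdivlMr// !ge_min lexx !orbT.
pose E := e * g; have E0 : 0 < E by rewrite mulr_gt0.
(* If d_i > 0, the weight makes w_i d_i s_i r_i y cancel al r_i y. If d_i = 0 nothing cancels, and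
   the summand n al^2 / E pays for al r_i y by Young's inequality against a share E / (4 n) of
   y^2. *)
pose w i := if d i == 0 then (e * C1 + n%:R * al ^+ 2 / E) / b i
            else al / (d i * s i).
have w0 i : 0 < w i.
  rewrite /w; case: eqVneq => di.
    by rewrite divr_gt0// addr_gt0// ?divr_gt0// mulr_gt0// exprn_gt0.
  by rewrite divr_gt0// mulr_gt0// lt_neqAle eq_sym di hd.
have hw i r y : al * r * y - w i * (d i * s i * (r * y)) - w i * (b i * r ^+ 2)
    <= E / (4 * n%:R) * y ^+ 2 - e * C1 * r ^+ 2.
  rewrite /w; have := hl i; rewrite /u; case: eqVneq => [->|di] li.
    rewrite !mul0r mulr0 subr0 [_ / b i * _]mulrA divfK ?gt_eqF//.
    have := sqr_ge0 (E * y - 2 * n%:R * al * r).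
    have h : (E * y - 2 * n%:R * al * r) ^+ 2 / (4 * n%:R * E) =
       E / (4 * n%:R) * y ^+ 2 - al * r * y + n%:R * al ^+ 2 / E * r ^+ 2.
      by field; rewrite !gt_eqF.
    rewrite -(pmulr_lge0 _ (x := (4 * n%:R * E)^-1)) ?invr_gt0 ?mulr_gt0//.
    rewrite h; lra.
  have h : al / (d i * s i) * (d i * s i * (r * y)) = al * r * y.
    by field; rewrite di gt_eqF.
  rewrite h subrr sub0r.
  have : e * C1 * r ^+ 2 <= b i * (al / (d i * s i)) * r ^+ 2.
    by rewrite ler_wpM2r ?sqr_ge0//; lra.
  have : 0 <= E / (4 * n%:R) * y ^+ 2.
    by rewrite mulr_ge0 ?sqr_ge0// divr_ge0// ltW// mulr_gt0.
  nra.
have ew : 4 * e ^+ 2 <= w i0.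
  rewrite /w gt_eqF// -/g; move: eg; rewrite !ler_pdivlMr// ?mulr_gt0//; nra.
have [k1 k10 hk1] := lyap_ge w0 ew.
exists w, e, (Num.min k1 (Num.min e (E / 2))).
  by rewrite lt_min k10/= lt_min e0/=; lra.
split=> [r y|m r y /andP[m0 mL]].
  by apply: le_trans (hk1 r y); rewrite ler_wpM2r ?sqn_ge0// ge_min lexx.
set k := Num.min _ _.
have ke : k <= e by rewrite ge_min; apply/orP; right; rewrite ge_min lexx.
have kE : k <= E / 2 by rewrite ge_min; apply/orP; right; rewrite ge_min lexx orbT.
set S := \sum_i r i; set Q := \sum_i r i ^+ 2.
have rQ : r i0 ^+ 2 <= Q.
  by rewrite /Q (bigD1 i0)//= lerDl; apply: sumr_ge0 => i _; rewrite sqr_ge0.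
have kQ : k * sqn r y <= E / 2 * y ^+ 2 + e * Q.
  rewrite /sqn -/Q mulrDr; apply: lerD; apply: ler_wpM2r => //; rewrite ?sqr_ge0//.
  exact: le_trans (sqr_ge0 _) rQ.
have H1 : al * y * S + \sum_i w i * (r i * (- b i * r i - (d i - 0) * s i * y))
   <= E / 4 * y ^+ 2 - e * C1 * Q.
  rewrite /S /Q !mulr_sumr -big_split/=.
  have -> : E / 4 * y ^+ 2 = \sum_(i < n) E / (4 * n%:R) * y ^+ 2.
    by rewrite sumr_const card_ord -mulr_natr; field; rewrite gt_eqF.
  rewrite -sumrB; apply: ler_sum => i _; apply: le_trans (hw i (r i) y).
  by rewrite le_eqVlt; apply/orP; left; apply/eqP; ring.
have H2 : e * (al * r i0 * S) <= e * (al / 2 * (n%:R * r i0 ^+ 2 + Q)).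
  rewrite ler_pM2l// -mulrA [leRHS](_ : _ = al * ((n%:R * r i0 ^+ 2 + Q) / 2)); last by ring.
  rewrite ler_pM2l// /S /Q mulr_sumr.
  have -> : n%:R * r i0 ^+ 2 = \sum_(i < n) r i0 ^+ 2.
    by rewrite sumr_const card_ord mulr_natl.
  rewrite -big_split/= mulr_suml; apply: ler_sum => i _.
  have := sqr_ge0 (r i0 - r i); nra.
(* As m may vanish, -m y^2 is spent entirely on the cross term that m itself creates. *)
have H3 : - (m * y ^+ 2) - e * m * (y * r i0) <= e * (L / 4 * r i0 ^+ 2).
  have h1 : 0 <= m * (y + e / 2 * r i0) ^+ 2 by rewrite mulr_ge0// sqr_ge0.
  have h2 : e * (e * m) * r i0 ^+ 2 <= e * L * r i0 ^+ 2.
    by rewrite ler_wpM2r ?sqr_ge0// ler_pM2l//; nra.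
  nra.
have H4 : - (e * (b i0 * (y * r i0))) <= e * (g / 4 * y ^+ 2 + b i0 ^+ 2 / g * r i0 ^+ 2).
  rewrite -mulrN ler_pM2l// -subr_ge0.
  have -> : g / 4 * y ^+ 2 + b i0 ^+ 2 / g * r i0 ^+ 2 - - (b i0 * (y * r i0)) =
     (g / 2 * y + b i0 * r i0) ^+ 2 / g by field; rewrite gt_eqF.
  by rewrite divr_ge0 ?sqr_ge0// ltW.
have H5 : e * (C0 * r i0 ^+ 2) <= e * (C0 * Q) by rewrite ler_pM2l// ler_wpM2l.
(* Balance: of -E y^2, a quarter goes to [H1], a quarter to [H4], and half remains. Of -e C1 Q,
   exactly -e Q remains. *)
have -> : dlyap w e r y (fun i => - b i * r i - (d i - 0) * s i * y)
    (al * S - 0 * (\sum_i s i) * y - m * y) =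
   (al * y * S + \sum_i w i * (r i * (- b i * r i - (d i - 0) * s i * y)))
   + e * (al * r i0 * S) + (- (m * y ^+ 2) - e * m * (y * r i0))
   + - (e * (b i0 * (y * r i0))) - E * y ^+ 2.
  by rewrite /dlyap /E /g; ring.
rewrite mulNr; move: H1 H2 H3 H4 H5 kQ; rewrite /C1 /C0 /E.
set X1 := _ + \sum_i _.
set X2 := b i0 ^+ 2 / g.
lra.
Qed.
End Lyapunov.

(** * Robustness of the decay under small changes of the coefficients *)

Section Perturbation.
Context (R : realFieldType) (n : nat) (i0 : 'I_n).

Lemma bilinear_le (k D h u v N : R) : `|D| <= h -> u ^+ 2 <= N -> v ^+ 2 <= N ->
  k * (D * (u * v)) <= `|k| * (h * N).
Proof.
move=> Dh uN vN; apply: le_trans (ler_norm _) _.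
have uvN : `|u * v| <= N.
  rewrite ler_norml; apply/andP; split.
    by have := sqr_ge0 (u + v); nra.
  by have := sqr_ge0 (u - v); nra.
by rewrite !(normrM k) ler_wpM2l// normrM ler_pM.
Qed.

Lemma lyap_le (w : 'I_n -> R) e :
  exists2 C : R, 0 < C & forall r y, lyap i0 w e r y <= C * sqn r y.
Proof.
exists (1 + \sum_i `|w i| + `|e|).
  by rewrite -addrA ltr_pwDl// addr_ge0// sumr_ge0.
move=> r y; rewrite /lyap !mulrDl; apply: lerD; first apply: lerD.
- by have := sqn_ge_y r y; have := sqr_ge0 y; lra.
- rewrite mulr_suml; apply: ler_sum => i _.
  have H : `|2^-1| <= 1 :> R by rewrite ger0_norm; lra.
  have := bilinear_le (w i) H (sqn_ge_r r y i) (sqn_ge_r r y i).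
  by rewrite mul1r; apply: le_trans; rewrite le_eqVlt; apply/orP; left; apply/eqP; field.
- have := @bilinear_le e 1 1 y (r i0) _ _ (sqn_ge_y r y) (sqn_ge_r r y i0).
  by rewrite !mul1r normr1; apply.
Qed.

(** The difference of the two values is a sum of terms (fixed number) times (coefficient change)
    times (product of two coordinates). The slope m is common to both sides and cancels, so no
    smallness is asked of it. *)
Lemma dlyap_perturb (w : 'I_n -> R) (e al c : R) (b d s : 'I_n -> R) :
  exists2 C : R, 0 < C & forall h al' c' b' d' m r y,
    `|al' - al| <= h -> `|c' - c| <= h ->
    (forall i, `|b' i - b i| <= h) -> (forall i, `|d' i - d i| <= h) ->
    dlyap i0 w e r y (fun i => - b' i * r i - (d' i - c') * s i * y)
      (al' * (\sum_i r i) - c' * (\sum_i s i) * y - m * y)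
    <= dlyap i0 w e r y (fun i => - b i * r i - (d i - c) * s i * y)
      (al * (\sum_i r i) - c * (\sum_i s i) * y - m * y) + C * (h * sqn r y).
Proof.
set S := \sum_i s i.
exists (1 + (\sum_(i < n) (1 + `|e|) + (`|- S| + `|- (e * S)|)
  + \sum_i (`|- w i| + `|- (w i * s i)| + `|w i * s i|)
  + (`|- e| + `|- (e * s i0)| + `|e * s i0|))).
  rewrite ltr_pwDl// !addr_ge0// sumr_ge0// => i _; rewrite !addr_ge0//.
move=> h al' c' b' d' m r y hal hc hb hd.
set N := sqn r y.
have yN : y ^+ 2 <= N := sqn_ge_y r y.
have rN i : r i ^+ 2 <= N := sqn_ge_r r y i.
have N0 : 0 <= N := sqn_ge0 r y.
have h0 : 0 <= h := le_trans (normr_ge0 _) hal.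
rewrite -lerBlDl mulrDl mul1r; apply: ler_wpDl; first exact: mulr_ge0.
rewrite [leLHS](_ : _ = \sum_i (1 * ((al' - al) * (y * r i)) +
   e * ((al' - al) * (r i0 * r i)))
   + (- S * ((c' - c) * (y * y)) + - (e * S) * ((c' - c) * (r i0 * y)))
   + \sum_i (- w i * ((b' i - b i) * (r i * r i))
         + - (w i * s i) * ((d' i - d i) * (r i * y))
         + (w i * s i) * ((c' - c) * (r i * y)))
   + (- e * ((b' i0 - b i0) * (y * r i0))
      + - (e * s i0) * ((d' i0 - d i0) * (y * y))
      + (e * s i0) * ((c' - c) * (y * y)))); last first.
  rewrite /dlyap.
  have -> : \sum_i (1 * ((al' - al) * (y * r i)) + e * ((al' - al) * (r i0 * r i)))
     = ((al' - al) * (y + e * r i0)) * (\sum_i r i).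
    by rewrite mulr_sumr; apply: eq_bigr => i _; ring.
  have -> : \sum_i w i * (r i * (- b' i * r i - (d' i - c') * s i * y)) =
    \sum_i w i * (r i * (- b i * r i - (d i - c) * s i * y)) +
    \sum_i (- w i * ((b' i - b i) * (r i * r i))
         + - (w i * s i) * ((d' i - d i) * (r i * y))
         + (w i * s i) * ((c' - c) * (r i * y))).
    by rewrite -big_split/=; apply: eq_bigr => i _; ring.
  ring.
rewrite ![in leRHS](mulrDl _ _ (h * N)) ![in leRHS]mulr_suml.
apply: lerD; first apply: lerD; first apply: lerD.
- apply: ler_sum => i _; rewrite [in leRHS]mulrDl -[1 in leRHS](@normr1 R).
  by apply: lerD; exact: bilinear_le.
- by apply: lerD; exact: bilinear_le.
- apply: ler_sum => i _; rewrite ![in leRHS]mulrDl.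
  by apply: lerD; first apply: lerD; exact: bilinear_le.
- by apply: lerD; first apply: lerD; exact: bilinear_le.
Qed.

(** With h = k / (2 P) the perturbation consumes half of the decay k [sqn]; [lyap] <= C [sqn] turns
    the other half into decay of [lyap] at rate k / (2 C). *)
Lemma lyapunov_perturbed (al c L : R) (b d s : 'I_n -> R) :
  0 < al -> 0 <= c -> 0 <= L -> (forall i, al <= b i) -> (forall i, 0 <= d i) ->
  0 < d i0 -> (forall i, 0 < s i) ->
  exists (w : 'I_n -> R) (e k C h : R), [/\ 0 < k, 0 < C, 0 < h,
   (forall r y, k * sqn r y <= lyap i0 w e r y <= C * sqn r y) &
   forall al' c' b' d' m r y, 0 <= m <= L ->
    `|al' - al| <= h -> `|c' - c| <= h ->
    (forall i, `|b' i - b i| <= h) -> (forall i, `|d' i - d i| <= h) ->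
     dlyap i0 w e r y (fun i => - b' i * r i - (d' i - c') * s i * y)
       (al' * (\sum_i r i) - c' * (\sum_i s i) * y - m * y)
     <= - k * lyap i0 w e r y].
Proof.
move=> al0 c0 L0 hb hd d0 s0.
have [w [e [k k0 [hk hdl]]]] := lyapunov_linear al0 c0 L0 hb hd d0 s0.
have [C C0 hC] := lyap_le w e.
have [P P0 hP] := dlyap_perturb w e al c b d s.
exists w, e, (Num.min k (k / (2 * C))), C, (k / (2 * P)).
have C20 : 0 < 2 * C by lra.
have P20 : 0 < 2 * P by lra.
split=> //; [by rewrite lt_min k0 divr_gt0|by rewrite divr_gt0| |].
  move=> r y; rewrite hC andbT; apply: le_trans (hk r y).
  by rewrite ler_wpM2r ?sqn_ge0// ge_min lexx.
move=> al' c' b' d' m r y hm hal hc hb' hd'.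
apply: le_trans (hP _ _ _ _ _ m r y hal hc hb' hd') _.
have h1 := hdl m r y hm.
have -> : P * (k / (2 * P) * sqn r y) = k / 2 * sqn r y.
  by field; rewrite gt_eqF.
have V0 : 0 <= lyap i0 w e r y.
  by apply: le_trans (hk r y); rewrite mulr_ge0 ?sqn_ge0// ltW.
have h2 : Num.min k (k / (2 * C)) * lyap i0 w e r y <= k / 2 * sqn r y.
  apply: (@le_trans _ _ (k / (2 * C) * lyap i0 w e r y)).
    by rewrite ler_wpM2r ?sqn_ge0// ge_min lexx orbT.
  have -> : k / 2 * sqn r y = k / (2 * C) * (C * sqn r y).
    by field; rewrite gt_eqF.
  by rewrite ler_pM2l ?divr_gt0.
move: h1 h2; rewrite !mulNr; lra.
Qed.

End Perturbation.

(** * Derivatives along a set and linear approximation *)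

Section DeriveWithin.
Context (R : realType) (V : normedModType R).
Implicit Types (A : set R) (f : R -> V) (l : V) (t : R).

(** Differentiability without division: the point s = t is not excluded, and one-sided, two-sided
    and vector-valued derivatives share one form that restricts to subsets. *)
Definition linear_approx A f t l : Prop := forall h : R, 0 < h ->
  \forall s \near t, A s -> `|f s - f t - (s - t) *: l| <= h * `|s - t|.

Lemma quotient_dist f l s t : s != t ->
  `|l - (s - t)^-1 *: (f s - f t)| = `|s - t|^-1 * `|f s - f t - (s - t) *: l|.
Proof.
move=> st; have st0 : s - t != 0 by rewrite subr_eq0.
rewrite -normfV -normrZ [X in _ = `|X|]scalerBr [in RHS]scalerA mulVf// scale1r; exact: distrC.
Qed.

Lemma has_derive_withinP A f t l :
  has_derive_within A f t l <-> linear_approx A f t l.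
Proof.
split.
  move=> /cvgrPdist_le H h h0; have /= := H h h0.
  rewrite near_withinE near_withinE => {}H; near=> s => As.
  have [->|st] := eqVneq s t; first by rewrite !subrr scale0r subr0 !normr0 mulr0.
  have /= : `|l - (s - t)^-1 *: (f s - f t)| <= h by move: st As; near: s.
  rewrite quotient_dist// mulrC ler_pdivrMr// normr_gt0 subr_eq0//.
move=> H; apply/cvgrPdist_le => h h0 /=.
rewrite near_withinE near_withinE; near=> s => /= st As.
rewrite quotient_dist// mulrC ler_pdivrMr ?normr_gt0 ?subr_eq0//.
by move: As; near: s; exact: H.
Unshelve. all: by end_near. Qed.

Lemma is_deriveP f t l : is_derive t 1 f l <-> linear_approx setT f t l.
Proof.
have E : is_derive t 1 f l <->
    h^-1 *: ((f \o shift t) (h *: 1) - f t) @[h --> 0^'] --> l.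
  split=> [[H <-]|H]; first exact: H.
  by split; [apply/cvg_ex; exists l|apply/cvg_lim].
rewrite E; split.
  move=> /cvgrPdist_le H h h0; have /= := H h h0.
  rewrite near_withinE => {}H; apply/nbhs0P; near=> s => _.
  have [->|s0] := eqVneq s 0; first by rewrite addr0 !subrr scale0r subr0 !normr0 mulr0.
  have tst : t + s != t by rewrite -subr_eq0 addrAC subrr add0r.
  have /= : `|l - s^-1 *: (f (s *: 1 + t) - f t)| <= h.
    by move: s0; near: s.
  have -> : s *: 1 + t = t + s by rewrite addrC [s *: 1]mulr1.
  rewrite -{1}[s](addKr t) [- t + _]addrC quotient_dist// mulrC ler_pdivrMr//.
  by rewrite normr_gt0 subr_eq0.
move=> H; apply/cvgrPdist_le => h h0 /=.
rewrite near_withinE; have /nbhs0P := H h h0; apply: filterS => s + s0.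
have -> : s *: 1 + t = t + s by rewrite addrC [s *: 1]mulr1.
have tst : t + s != t by rewrite -subr_eq0 addrAC subrr add0r.
move=> /(_ Logic.I) Hs.
rewrite -{1}[s](addKr t) [- t + _]addrC quotient_dist// mulrC ler_pdivrMr//.
by rewrite normr_gt0 subr_eq0.
Unshelve. all: by end_near. Qed.

Lemma linear_approx_sub A B f t l :
  B `<=` A -> linear_approx A f t l -> linear_approx B f t l.
Proof. by move=> BA H h /H; apply: filterS => s + /BA. Qed.

Lemma linear_approx_nbhs A f t l :
  nbhs t A -> linear_approx A f t l -> linear_approx setT f t l.
Proof.
by move=> tA H h /H; apply: filterS2 tA => s As + _; exact.
Qed.

Lemma linear_approx_cvg A f t l :
  linear_approx A f t l -> f @ within A (nbhs t) --> f t.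
Proof.
move=> H; apply/cvgrPdist_le => e e0; rewrite near_withinE.
have C0 : 0 < 1 + `|l| by rewrite ltr_pwDl.
have d0 : 0 < e / (1 + `|l|) by rewrite divr_gt0.
have := H 1 ltr01; apply: filterS2 (nbhsx_ballx t _ d0) => s.
rewrite /ball/= mul1r distrC => st + As => /(_ As) fs.
rewrite distrC -[f s - f t](subrK ((s - t) *: l)).
apply: le_trans (ler_normD _ _) _; rewrite normrZ.
have : `|s - t| * (1 + `|l|) <= e by rewrite -ler_pdivlMr// ltW.
lra.
Qed.

End DeriveWithin.

(** This replaces a nonlinear term by an exactly linear one with a nearby coefficient. At s = x any
    slope fits, and d itself is taken. *)
Lemma is_derive_slope (R : realType) (f : R -> R) (x d h : R) :
  is_derive x 1 f d -> 0 < h ->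
  \forall s \near x, exists2 d', `|d' - d| <= h & f s - f x = d' * (s - x).
Proof.
move=> /is_deriveP H h0; have := H h h0; apply: filterS => s /(_ Logic.I).
have [-> _|sx] := eqVneq s x.
  by exists d; rewrite ?subrr ?normr0 ?mulr0// ltW.
move: sx; rewrite -subr_eq0 => sx H1; rewrite /GRing.scale/= in H1 *; exists ((f s - f x) / (s - x)); last by rewrite divfK.
have -> : (f s - f x) / (s - x) - d = (s - x)^-1 * (f s - f x - (s - x) *: d).
  by rewrite mulrBr /GRing.scale/= mulKf// mulrC.
by rewrite normrM normfV mulrC ler_pdivrMr// normr_gt0.
Qed.

Lemma nondecreasing_is_derive_ge0 (R : realType) (f : R -> R) (x d : R) :
  is_derive x 1 f d ->
  (\forall s \near x, x <= s -> f x <= f s) -> 0 <= d.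
Proof.
move=> fd fx; rewrite leNgt; apply/negP => d0.
have h0 : 0 < - d / 2 by lra.
have [e /= e0 H] : nbhs_ball x [set s | (x <= s -> f x <= f s) /\
    exists2 d', `|d' - d| <= - d / 2 & f s - f x = d' * (s - x)].
  by apply/nbhs_ballP; apply: filterI fx _; exact: is_derive_slope.
have [|H1 [d' d'd]] := H (x + e / 2).
  by rewrite /ball/= opprD addNKr normrN gtr0_norm; lra.
have /H1 : x <= x + e / 2 by lra.
rewrite [x + _]addrC addrK; have : d' < 0 by move: d'd; rewrite ler_norml; lra.
by move: e0; nra.
Qed.

Lemma nbhs_nonneg (R : realType) (x : R) : 0 < x -> nbhs x (`[0, +oo[%classic : set R).
Proof.
by move=> x0; apply: filterS (lt_nbhsr x0) => y y0; rewrite /= in_itv/= andbT ltW.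
Qed.

Lemma has_derive_within_interior (R : realType) (f : R -> R) (x d : R) :
  0 < x -> has_derive_within `[0, +oo[ f x d -> is_derive x 1 f d.
Proof.
move=> x0 /has_derive_withinP H; apply/is_deriveP.
exact: linear_approx_nbhs (nbhs_nonneg x0) H.
Qed.

(** Mean value theorem on a ball in the open half-line where continuity keeps the derivative below
    |f'(x)| + 1. *)
Lemma C1_nonneg_lipschitz (R : realType) (f : R -> R) (x : R) :
  C1_nonneg f -> 0 < x -> exists2 r, 0 < r & exists2 L, 0 <= L &
    forall u v, `|u - x| <= r -> `|v - x| <= r -> `|f u - f v| <= L * `|u - v|.
Proof.
move=> [f' fd fc] x0.
have fdx (y : R) : 0 < y -> is_derive y 1 f (f' y).
  by move=> y0; apply: has_derive_within_interior => //; apply/fd/ltW.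
have f'x : f' @ x --> f' x.
  move/subspace_continuousP : fc => /(_ x); rewrite /= in_itv/= andbT ltW// => /(_ isT).
  by rewrite within_interior//; exact: nbhs_nonneg.
have [r r0 H] : exists2 r, 0 < r & forall u, `|u - x| <= r -> 0 < u /\ `|f' u| <= `|f' x| + 1.
  have [e /= e0 H] : nbhs_ball x [set u | 0 < u /\ `|f' x - f' u| < 1].
    by apply/nbhs_ballP; apply: filterI; [exact: lt_nbhsr|move/cvgrPdist_lt: f'x; exact].
  exists (e / 2); first by lra.
  move=> u ux; have [|u0 fu] := H u; first by rewrite /ball/= distrC; lra.
  split=> //; have := ler_dist_dist (f' x) (f' u).
  have := ler_normB (f' x) (f' x - f' u); rewrite subKr; lra.
exists r => //; exists (`|f' x| + 1); first by rewrite addr_ge0.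
move=> u v; wlog uv : u v / u <= v.
  move=> K ux vx; have [/K|/ltW /K] := leP u v; first exact.
  by move=> H'; rewrite distrC [`|u - v|]distrC; exact: H'.
move=> ux vx.
have xuv c : c \in `[u, v]%R -> `|c - x| <= r.
  by move: ux vx; rewrite in_itv/= !ler_norml => ? ? ?; lra.
have [c cuv fE] : exists2 c, c \in `[u, v]%R & f v - f u = f' c * (v - u).
  apply: MVT_segment => //.
    move=> c cuv; apply: fdx.
    by have [] := H c (xuv _ (subset_itv_oo_cc cuv)).
  apply: derivable_within_continuous => c cuv.
  by have [c0 _] := H c (xuv _ cuv); have [] := fdx c c0.
rewrite distrC [`|u - v|]distrC fE normrM ler_wpM2r//.
by have [] := H c (xuv _ cuv).
Qed.

(** * Trapping below a level of a Lyapunov function *)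

Section Trapping.
Context (R : realType).
Implicit Types (v : R -> R) (b k th T : R).

(** The product (1 + k t) v has derivative at most -k^2 t v <= 0. This rational decay replaces the
    exponential one and still forces v to 0 when k > 0. *)
Lemma decay_le v v' b k : 0 < b -> 0 <= k ->
  {within `[0, b], continuous v} ->
  (forall t, 0 < t < b ->
    [/\ is_derive t 1 v (v' t), 0 <= v t & v' t <= - k * v t]) ->
  v b * (1 + k * b) <= v 0.
Proof.
move=> b0 k0 vc vd; pose w t : R := v t * (1 + k * t).
have wd (t : R) : 0 < t < b -> is_derive t 1 w (v t * k + (1 + k * t) * v' t).
  move=> /vd[vdt _ _].
  have ld : is_derive t 1 (cst 1 + k \*: id : R -> R) k.
    by apply: is_derive_eq; rewrite add0r /GRing.scale/= mulr1.
  by apply: is_derive_eq.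
have wc : {within `[0, b], continuous w}.
  apply/subspace_continuousP => t tb; apply: cvgM.
    by move/subspace_continuousP: vc; exact.
  by apply: cvgD; [exact: cvg_cst|apply: cvgM; [exact: cvg_cst|exact: cvg_within]].
have [t tb w0b] := MVT b0 (fun t (tb : t \in `]0, b[%R) => wd t tb) wc.
move: tb; rewrite in_itv/= => tb; have [_ vt0 v't] := vd t tb.
have : (v t * k + (1 + k * t) * v' t) * (b - 0) <= 0.
  rewrite subr0 pmulr_lle0//.
  have : (1 + k * t) * v' t <= (1 + k * t) * (- k * v t).
    by rewrite ler_pM2l// ltr_wpDr// mulr_ge0//; lra.
  have : 0 <= (k * k) * t * v t by rewrite !mulr_ge0//; lra.
  lra.
by rewrite -w0b /w mulr0 addr0 mulr1; lra.
Qed.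

(** A continuation argument: the differential inequality is known only below level [th], so the
    infimum of the times at or above that level is examined. *)
Lemma trapping v v' k th T : 0 <= k ->
  (forall t, 0 <= t < T -> v @ within `[0, T[ (nbhs t) --> v t) ->
  (forall t, 0 < t < T -> is_derive t 1 v (v' t)) ->
  (forall t, 0 <= t < T -> 0 <= v t) ->
  (forall t, 0 < t < T -> v t < th -> v' t <= - k * v t) ->
  v 0 < th -> forall t, 0 <= t < T -> v t < th /\ v t * (1 + k * t) <= v 0.
Proof.
move=> k0 vc vd v0 vk v0th.
have decay (b : R) : 0 <= b < T -> (forall t, 0 < t < b -> v t < th) ->
    v b * (1 + k * b) <= v 0.
  rewrite le_eqVlt => /andP[/orP[/eqP<-|b0] bT] bth.
    by rewrite mulr0 addr0 mulr1.
  apply: (@decay_le v v') => //.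
    apply: (@continuous_subspaceW _ _ _ `[0, T[).
      by move=> t; rewrite /= !in_itv/= => /andP[-> /le_lt_trans ->].
    by apply/subspace_continuousP => t; rewrite /= in_itv/=; exact: vc.
  move=> t /andP[t0 tb]; have tT : t < T by lra.
  split; [apply: vd; lra|apply: v0; lra|].
  by apply: vk; [lra|apply: bth; lra].
have lt t : 0 <= t < T -> v t < th.
  move=> t0T; rewrite ltNge; apply/negP => thv.
  pose E := [set s | 0 <= s < T /\ th <= v s].
  have infE : has_inf E by split; [exists t|exists 0 => s [/andP[]]].
  have s0 : 0 <= inf E by apply: lb_le_inf; [exists t|move=> s [/andP[]]].
  have sT : inf E < T.
    by apply: (@le_lt_trans _ _ t); [apply: ge_inf => //; exists 0 => s [/andP[]]|lra].
  have below s : 0 <= s < inf E -> v s < th.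
    move=> /andP[s1 s2]; rewrite ltNge; apply/negP => ths.
    have : inf E <= s by apply: ge_inf; [exists 0 => u [/andP[]]|split=> //; lra].
    by rewrite leNgt s2.
  (* Before the infimum the decay estimate applies, so v there is at most v 0. Continuity then keeps
     v below [th] slightly later, against the definition of the infimum. *)
  have vs : v (inf E) < th.
    have vE0 : 0 <= v (inf E) by apply: v0; rewrite s0.
    have : v (inf E) * (1 + k * inf E) <= v 0.
      apply: decay; first by rewrite s0.
      by move=> s sE; apply: below; lra.
    have := mulr_ge0 vE0 (mulr_ge0 k0 s0); lra.
  have := vc (inf E); rewrite s0 sT => /(_ isT) /cvgrPdist_lt.
  move=> /(_ (th - v (inf E))); rewrite subr_gt0 => /(_ vs).
  rewrite near_withinE => /nbhs_ballP[e /= e0 He].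
  have [s [s1 ths] se] := inf_adherent e0 infE.
  have ls : inf E <= s by apply: ge_inf => //; exists 0 => u [/andP[]].
  have := He s; rewrite /ball/= in_itv/= s1 ler0_norm; last by lra.
  by rewrite ltr_norml => /(_ _ isT) H; have := H ltac:(lra); lra.
by move=> t t0T; split; [exact: lt|apply: decay => // s s0t; apply: lt; lra].
Qed.
End Trapping.

(** * Global solutions of bounded Lipschitz systems *)

Section Picard.
Context (R : realType).

(** Integration starts at -1 so that 0 is an interior point and the fundamental theorem gives a
    two-sided derivative there. *)
Definition primitive (h : R -> R) (t : R) : R :=
  (\int[lebesgue_measure]_(s in `[(-1), t]) h s)%R
  - (\int[lebesgue_measure]_(s in `[(-1), 0%R]) h s)%R.

Lemma primitive0 h : primitive h 0 = 0.
Proof. exact: subrr. Qed.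

Lemma is_derive_primitive (h : R -> R) (t : R) : continuous h -> 0 <= t ->
  is_derive t 1 (primitive h) (h t).
Proof.
move=> hc t0.
pose F (x : R) : R := (\int[lebesgue_measure]_(s in `[(-1), x]) h s)%R.
have [dF F't] : derivable F t 1 /\ derive1 F t = h t.
  apply: (@continuous_FTC1_closed R h (-1) t (t + 1)).
  - by rewrite ltrDl.
  - apply: continuous_compact_integrable; first exact: segment_compact.
    exact: continuous_subspaceT.
  - by apply: lt_le_trans t0; rewrite ltrN10.
  - exact: hc.
have Ft : is_derive t 1 F (h t).
  by apply: DeriveDef; [exact: dF|rewrite -derive1E F't].
have E : primitive h = F - cst (F 0) by [].
rewrite E; clearbody F.
by apply: is_derive_eq; rewrite subr0.
Qed.

(** Both psi + u and psi - u are nondecreasing. *)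
Lemma derive_bound (u u' psi psi' : R -> R) :
  (forall t : R, 0 <= t -> is_derive t 1 u (u' t)) ->
  (forall t : R, 0 <= t -> is_derive t 1 psi (psi' t)) ->
  (forall t, 0 <= t -> `|u' t| <= psi' t) ->
  forall t, 0 <= t -> `|u t - u 0| <= psi t - psi 0.
Proof.
have mono (w w' : R -> R) :
    (forall t : R, 0 <= t -> is_derive t 1 w (w' t)) ->
    (forall t, 0 <= t -> 0 <= w' t) -> forall t, 0 <= t -> w 0 <= w t.
  move=> dw w0 t t0.
  have dw' (c : R) : c \in `]0, t[%R -> is_derive c 1 w (w' c).
    by rewrite in_itv/= => /andP[/ltW + _]; exact: dw.
  have wc : {within `[0, t], continuous w}.
    apply: derivable_within_continuous => c; rewrite in_itv/= => /andP[c0 _].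
    by have [] := dw c c0.
  have [c + wt] := MVT_segment t0 dw' wc; rewrite in_itv/= => /andP[c0 _].
  by rewrite -subr_ge0 wt subr0 mulr_ge0// w0.
move=> du dpsi uu t t0.
have uu' s : 0 <= s -> - psi' s <= u' s <= psi' s.
  by move=> /uu; rewrite ler_norml.
have H1 := mono (psi + u) (fun s => psi' s + u' s)
  (fun s s0 => is_deriveD (dpsi s s0) (du s s0)).
have H2 := mono (psi - u) (fun s => psi' s - u' s)
  (fun s s0 => is_deriveB (dpsi s s0) (du s s0)).
have {}H1 : psi 0 + u 0 <= psi t + u t.
  by apply: H1 => // s s0; have := uu' s s0; lra.
have {}H2 : psi 0 - u 0 <= psi t - u t.
  by apply: H2 => // s s0; have := uu' s s0; lra.
rewrite ler_norml; lra.
Qed.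

Lemma dist_max_le (a s t : R) :
  `|Num.max s a - Num.max t a| <= `|s - t|.
Proof.
have := ler_norm (s - t); have := ler_norm (t - s); rewrite [`|t - s|]distrC => h1 h2.
rewrite ler_norml /Num.max.
have h3 := normr_ge0 (s - t).
by case: (ltP s a) => ?; case: (ltP t a) => ?; lra.
Qed.

(** The bounds a_k - 2D/2^k increase and a_k + 2D/2^k decrease, so the supremum of the former lies
    between them; this yields the limit together with its rate. *)
Lemma geometric_limit (a : nat -> R) (D : R) :
  (forall k, `|a k.+1 - a k| <= D / 2 ^+ k) ->
  exists l : R, forall k, `|l - a k| <= 2 * D / 2 ^+ k.
Proof.
move=> ha; pose b k := a k - 2 * D / 2 ^+ k; pose c k := a k + 2 * D / 2 ^+ k.
have half k : D / 2 ^+ k = 2 * D / 2 ^+ k.+1.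
  by rewrite exprS invfM; field; rewrite expf_neq0.
have D0 k : 0 <= D / 2 ^+ k by apply: le_trans (ha k).
have bb : {homo b : i j / (i <= j)%N >-> i <= j}.
  apply: homo_leq => [//|? ? ?|k]; first exact: le_trans.
  have := ha k; rewrite /b -half -mulrA ler_norml; lra.
have cc : {homo c : i j / (i <= j)%N >-> j <= i}.
  apply: (homo_leq (r := fun x y => y <= x)) => [//|? ? ? h1 h2|k].
    exact: le_trans h2 h1.
  have := ha k; rewrite /c -half -mulrA ler_norml; lra.
have bc i j : b i <= c j.
  apply: le_trans (bb _ _ (leq_maxl i j)) _; apply: le_trans (cc _ _ (leq_maxr i j)).
  by have := D0 (maxn i j); rewrite /b /c -mulrA; lra.
have supb : has_sup (range b) by split; [exists (b 0%N), 0%N|exists (c 0%N) => _ [k _ <-]].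
exists (sup (range b)) => k.
have bs : b k <= sup (range b) by apply: (sup_upper_bound supb); exists k.
have sc : sup (range b) <= c k.
  by apply: ge_sup; [exists (b 0%N), 0%N|move=> _ [j _ <-]].
rewrite ler_norml; move: bs sc; rewrite {1}/b /c; lra.
Qed.

Lemma le_geometric (x y D : R) : (forall k : nat, x <= y + D / 2 ^+ k) -> x <= y.
Proof.
move=> H; rewrite leNgt; apply/negP => yx.
have e0 : 0 < x - y by lra.
pose k := Num.bound (D / (x - y)).
have : D / 2 ^+ k < x - y.
  have := upper_nthrootP (leqnn k).
  by rewrite ltr_pdivrMr// ltr_pdivrMr ?exprn_gt0// mulrC.
have := H k; lra.
Qed.

(* The integrand is frozen at time 0 for negative times, so that every iterate
   is differentiable on both sides at 0. *)
Definition picard_step (I : Type) (G : (I -> R) -> I -> R) (x0 : I -> R)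
    (X : R -> I -> R) (t : R) (i : I) : R :=
  x0 i + primitive (fun s : R => G (X (Num.max s 0)) i) t.

Section Existence.
Context (I : Type) (G : (I -> R) -> I -> R) (x0 : I -> R) (M L : R).
Hypotheses (M0 : 0 <= M) (L0 : 0 < L).
Hypothesis GM : forall u i, `|G u i| <= M.
Hypothesis GL : forall u v i (h : R), (forall j, `|u j - v j| <= h) ->
  `|G u i - G v i| <= L * h.

(** M bounds the speed, so all iterates share this modulus and it passes to their pointwise limit,
    whose continuity then needs no uniform convergence. *)
Definition time_lipschitz (X : R -> I -> R) : Prop :=
  forall (s t : R) i, 0 <= s -> 0 <= t -> `|X s i - X t i| <= M * `|s - t|.

Lemma frozen_continuous X i : time_lipschitz X ->
  continuous (fun s : R => G (X (Num.max s 0)) i).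
Proof.
move=> XL t; apply/cvgrPdist_lt => e e0.
have LM0 : 0 < 1 + L * M by rewrite ltr_pwDl// mulr_ge0// ltW.
have d0 : 0 < e / (1 + L * M) by rewrite divr_gt0.
apply: filterS (nbhsx_ballx t _ d0) => s; rewrite /ball/= ltr_pdivlMr// => ts.
have : `|G (X (Num.max t 0)) i - G (X (Num.max s 0)) i| <= L * (M * `|t - s|).
  apply: GL => j; have mx (z : R) : 0 <= Num.max z 0 by rewrite le_max lexx orbT.
  apply: le_trans (XL _ _ j (mx t) (mx s)) _; rewrite ler_wpM2l//.
  exact: dist_max_le.
have := normr_ge0 (t - s); nra.
Qed.

Lemma is_derive_picard_step X i (t : R) : time_lipschitz X -> 0 <= t ->
  is_derive t 1 ((picard_step G x0 X)^~ i) (G (X t) i).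
Proof.
move=> XL t0.
have := is_derive_primitive (frozen_continuous (i := i) XL) t0.
rewrite /= max_l// => H; rewrite /picard_step.
have := is_deriveD (is_derive_cst (x0 i) t 1) H.
by rewrite add0r.
Qed.

Lemma picard_step0 X : picard_step G x0 X 0 = x0.
Proof. by apply/funext => i; rewrite /picard_step primitive0 addr0. Qed.

Lemma picard_step_lipschitz X : time_lipschitz X -> time_lipschitz (picard_step G x0 X).
Proof.
move=> XL s t i; wlog st : s t / s <= t.
  move=> H s0 t0; have [st|/ltW ts] := leP s t; first exact: H.
  by rewrite distrC [`|s - t|]distrC; exact: H.
move=> s0 t0; rewrite distrC [`|s - t|]distrC.
have dw (c : R) : c \in `[s, t]%R ->
    is_derive c 1 ((picard_step G x0 X)^~ i) (G (X c) i).
  rewrite in_itv/= => /andP[sc _]; apply: is_derive_picard_step => //.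
  exact: le_trans sc.
have [c _ ->] := MVT_segment st (fun c (cst : c \in `]s, t[%R) => dw c (subset_itv_oo_cc cst))
  (derivable_within_continuous (fun c cst => @ex_derive _ _ _ _ _ _ _ (dw c cst))).
by rewrite normrM ler_wpM2r.
Qed.

Lemma is_derive_expM (C k t : R) :
  is_derive t 1 (fun s => C * expR (k * s)) (k * C * expR (k * t)).
Proof.
have H1 : is_derive t 1 (k \*: id : R -> R) k.
  by apply: is_derive_eq; rewrite /GRing.scale/= mulr1.
have := is_deriveZ C (is_derive1_comp (is_derive_expR (k * t)) H1).
by move=> /is_derive_eq; apply; rewrite /GRing.scale/=; ring.
Qed.

(** The weight exp(2 L t) has derivative 2 L times itself, so each iteration halves the weighted
    distance on the whole half-line at once, with no gluing of short intervals. C = M / (2 L) makes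
    the first step fit under the weight. *)
Lemma picard : exists x : R -> I -> R, x 0 = x0 /\
  forall (t : R) i, 0 <= t -> is_derive t 1 (x^~ i) (G (x t) i).
Proof.
pose X k := iter k (picard_step G x0) (fun=> x0).
have XL k : time_lipschitz (X k).
  elim: k => [|k IH]; last exact: picard_step_lipschitz.
  by move=> s t i _ _; rewrite subrr normr0 mulr_ge0.
have X0 k : X k 0 = x0 by case: k => // k; exact: picard_step0.
pose C := M / (2 * L); pose E (t : R) := expR (2 * L * t).
have L20 : 0 < 2 * L by rewrite mulr_gt0.
have C0 : 0 <= C by rewrite divr_ge0// ltW.
have E0 t : 0 <= E t := expR_ge0 _.
have dX k i (t : R) : 0 <= t -> is_derive t 1 ((X k.+1)^~ i) (G (X k t) i).
  exact: is_derive_picard_step.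
have dE k (t : R) : is_derive t 1 (fun s => C / 2 ^+ k * E s)
    (2 * L * (C / 2 ^+ k) * E t) := is_derive_expM _ _ _.
have CE0 k t : 0 <= C / 2 ^+ k * E t by rewrite mulr_ge0// divr_ge0// exprn_ge0.
have half k t : 2 * L * (C / 2 ^+ k.+1) * E t = L * (C / 2 ^+ k * E t).
  by rewrite exprS invfM; field; rewrite expf_neq0.
have step k t i : 0 <= t -> `|X k.+1 t i - X k t i| <= C / 2 ^+ k * E t.
  elim: k t i => [|k IH] t i t0.
    have := @derive_bound _ _ _ _ (fun t t0 => dX 0%N i t t0) (fun t _ => dE 0%N t) _ t t0.
    rewrite X0 => H; apply: le_trans (H _) _; last by rewrite gerBl.
    move=> s s0; apply: le_trans (GM _ _) _.
    rewrite expr0 divr1 /C [2 * L * _]mulrC divfK ?gt_eqF//.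
    by rewrite ler_peMr// -[1]addr0; apply: le_trans (expR_ge1Dx _); rewrite lerD2l !mulr_ge0// ltW.
  have H : `|(X k.+2 t i - X k.+1 t i) - (X k.+2 0 i - X k.+1 0 i)| <=
      C / 2 ^+ k.+1 * E t - C / 2 ^+ k.+1 * E 0.
    apply: (@derive_bound (fun t => X k.+2 t i - X k.+1 t i)
      (fun t => G (X k.+1 t) i - G (X k t) i)
      _ (fun t => 2 * L * (C / 2 ^+ k.+1) * E t)) => // s s0.
      exact: is_deriveB (dX k.+1 i s s0) (dX k i s s0).
    by rewrite half; apply: GL => j; exact: IH.
  by move: H; rewrite !X0 subrr subr0 => /le_trans; apply; rewrite gerBl.
clearbody X E C.
have [Y HY] : exists Y : R -> I -> R, forall t i k, 0 <= t ->
    `|Y t i - X k t i| <= 2 * (C * E t) / 2 ^+ k.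
  have /choice[Y HY] : forall ti : R * I, exists l : R, forall k, 0 <= ti.1 ->
      `|l - X k ti.1 ti.2| <= 2 * (C * E ti.1) / 2 ^+ k.
    move=> [t i] /=; have [t0|t0] := leP 0 t; last by exists 0.
    have [|l Hl] := @geometric_limit (fun k => X k t i) (C * E t); last by exists l.
    by move=> k; rewrite mulrAC; exact: step.
  by exists (fun t i => Y (t, i)) => t i k; exact: (HY (t, i)).
have YL : time_lipschitz Y.
  move=> s t i s0 t0.
  apply: (@le_geometric _ _ (2 * (C * E s) + 2 * (C * E t))) => k.
  have := HY s i k s0; have := HY t i k t0; have := XL k s t i s0 t0.
  rewrite mulrDl; have := ler_distD (X k s i) (Y s i) (Y t i).
  have := ler_distD (X k t i) (X k s i) (Y t i); rewrite [`|X k t i - Y t i|]distrC.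
  lra.
(* One more step applied to Y: it is a primitive, hence differentiable on both sides even at 0,
   whereas Y is controlled only for t >= 0, where the two agree. *)
exists (picard_step G x0 Y); split=> [|t i t0]; first exact: picard_step0.
suff -> : picard_step G x0 Y t = Y t by exact: is_derive_picard_step.
apply/funext => j; apply/eqP; rewrite -subr_eq0 -normr_le0.
apply: (@le_geometric _ _ (2 * (C * E t))) => k; rewrite add0r.
have H : `|(picard_step G x0 Y t j - X k.+1 t j)
      - (picard_step G x0 Y 0 j - X k.+1 0 j)| <= C / 2 ^+ k * E t - C / 2 ^+ k * E 0.
  apply: (@derive_bound (fun t => picard_step G x0 Y t j - X k.+1 t j)
    (fun t => G (Y t) j - G (X k t) j)
    (fun t => C / 2 ^+ k * E t) (fun t => 2 * L * (C / 2 ^+ k) * E t) _ _ _ t t0) => s s0.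
    exact: is_deriveB (is_derive_picard_step j YL s0) (dX k j s s0).
  rewrite [leRHS](_ : _ = L * (2 * (C * E s) / 2 ^+ k)); last first.
    by field; rewrite expf_neq0.
  by apply: GL => i'; exact: HY.
move: H; rewrite picard_step0 X0 subrr subr0.
have := HY t j k.+1 t0; have := ler_distD (X k.+1 t j) (picard_step G x0 Y t j) (Y t j).
have -> : 2 * (C * E t) / 2 ^+ k.+1 = C / 2 ^+ k * E t.
  by rewrite exprS invfM; field; rewrite expf_neq0.
have -> : 2 * (C * E t) / 2 ^+ k = 2 * (C / 2 ^+ k * E t).
  by field; rewrite expf_neq0.
by rewrite [`|X k.+1 t j - Y t j|]distrC; have := CE0 k 0; lra.
Qed.

End Existence.
End Picard.

(** * Bounded Lipschitz functions and clamping *)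

Section BoundedLipschitz.
Context (R : realType) (I : Type).
Implicit Types g k : (I -> R) -> R.

(** Boundedness is carried along because it makes the class closed under products. The hypothesis on
    h encodes the sup distance of families over any index type. *)
Definition bounded_lipschitz g : Prop := exists M L : R,
  [/\ 0 <= M, 0 <= L, forall u, `|g u| <= M &
   forall u v (h : R), (forall j, `|u j - v j| <= h) -> `|g u - g v| <= L * h].

Lemma bounded_lipschitz_cst (a : R) : bounded_lipschitz (fun=> a).
Proof. by exists `|a|, 0; split=> // u v h _; rewrite subrr normr0 mul0r. Qed.

Lemma bounded_lipschitzD g k : bounded_lipschitz g -> bounded_lipschitz k ->
  bounded_lipschitz (fun u => g u + k u).
Proof.
move=> [M [L [M0 L0 gM gL]]] [M' [L' [M'0 L'0 kM kL]]].
exists (M + M'), (L + L'); split; rewrite ?addr_ge0//.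
  by move=> u; apply: le_trans (ler_normD _ _) _; rewrite lerD.
move=> u v h uv; rewrite mulrDl opprD addrACA.
by apply: le_trans (ler_normD _ _) _; rewrite lerD// ?gL// kL.
Qed.

Lemma bounded_lipschitzM g k : bounded_lipschitz g -> bounded_lipschitz k ->
  bounded_lipschitz (fun u => g u * k u).
Proof.
move=> [M [L [M0 L0 gM gL]]] [M' [L' [M'0 L'0 kM kL]]].
exists (M * M'), (M * L' + M' * L); split; rewrite ?addr_ge0 ?mulr_ge0//.
  by move=> u; rewrite normrM ler_pM.
move=> u v h uv.
have -> : g u * k u - g v * k v = g u * (k u - k v) + k v * (g u - g v) by ring.
apply: le_trans (ler_normD _ _) _; rewrite !normrM mulrDl -!mulrA.
by rewrite lerD// ler_pM// ?gL// kL.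
Qed.

Lemma bounded_lipschitzB g k : bounded_lipschitz g -> bounded_lipschitz k ->
  bounded_lipschitz (fun u => g u - k u).
Proof.
move=> gl kl; have -> : (fun u => g u - k u) = (fun u => g u + (-1) * k u).
  by apply/funext => u; rewrite mulN1r.
by apply: bounded_lipschitzD => //; apply: bounded_lipschitzM => //;
   exact: bounded_lipschitz_cst.
Qed.

Lemma bounded_lipschitz_sum n (g : 'I_n -> (I -> R) -> R) :
  (forall i, bounded_lipschitz (g i)) ->
  bounded_lipschitz (fun u => \sum_i g i u).
Proof.
elim: n g => [|n IH] g gl.
  have -> : (fun u => \sum_i g i u) = (fun=> 0).
    by apply/funext => u; rewrite big_ord0.
  exact: bounded_lipschitz_cst.
have -> : (fun u => \sum_i g i u) = (fun u => g ord0 u + \sum_i g (lift ord0 i) u).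
  by apply/funext => u; rewrite big_ord_recl.
by apply: bounded_lipschitzD => //; apply: IH.
Qed.

Definition clamp (lo hi x : R) : R := Num.max lo (Num.min hi x).

Lemma clamp_bound lo hi x : lo <= hi -> lo <= clamp lo hi x <= hi.
Proof. by move=> lohi; rewrite /clamp le_max lexx ge_max lohi ge_min lexx. Qed.

Lemma clamp_id lo hi x : lo <= x <= hi -> clamp lo hi x = x.
Proof. by case/andP => lx xh; rewrite /clamp min_r// max_r. Qed.

Lemma dist_clamp_le lo hi x y : lo <= hi ->
  `|clamp lo hi x - clamp lo hi y| <= `|x - y|.
Proof.
move=> lohi.
have := ler_norm (x - y); have := ler_norm (y - x); rewrite [`|y - x|]distrC => h1 h2.
have h3 := normr_ge0 (x - y).
rewrite ler_norml /clamp /Num.min /Num.max.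
by case: (ltP hi x) => ?; case: (ltP hi y) => ?;
   case: ltP => ?; case: ltP => ?; lra.
Qed.

(** [clamp] is 1-Lipschitz with values in [lo, hi], so a Lipschitz bound on that interval becomes a
    global one. *)
Lemma bounded_lipschitz_clamp (lo hi L : R) (phi : R -> R) (j : I) :
  lo <= hi -> 0 <= L ->
  (forall x y, lo <= x <= hi -> lo <= y <= hi -> `|phi x - phi y| <= L * `|x - y|) ->
  bounded_lipschitz (fun u => phi (clamp lo hi (u j))).
Proof.
move=> lohi L0 phiL; exists (`|phi lo| + L * (hi - lo)), L; split => //.
- by rewrite addr_ge0// mulr_ge0// subr_ge0.
- move=> u; have cb := clamp_bound (u j) lohi.
  rewrite -[phi (clamp _ _ _)](subrK (phi lo)) addrC.
  apply: le_trans (ler_normD _ _) _; rewrite lerD2l.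
  apply: le_trans (phiL _ _ cb _) _; first by rewrite lexx.
  by rewrite ler_wpM2l// ger0_norm; lra.
- move=> u v h uv; apply: le_trans (phiL _ _ (clamp_bound _ lohi) (clamp_bound _ lohi)) _.
  by rewrite ler_wpM2l//; apply: le_trans (uv j); exact: dist_clamp_le.
Qed.

End BoundedLipschitz.

Lemma global_solution (R : realType) (I : finType) (G : (I -> R) -> I -> R) (x0 : I -> R) :
  (forall i, bounded_lipschitz (G^~ i)) ->
  exists x : R -> I -> R, x 0 = x0 /\
    forall (t : R) i, 0 <= t -> is_derive t 1 (x^~ i) (G (x t) i).
Proof.
move=> Gl.
have /choice[M HM] : forall i, exists M : R, 0 <= M /\ forall u, `|G u i| <= M.
  by move=> i; have [M [L [? ? ? ?]]] := Gl i; exists M.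
have /choice[L HL] : forall i, exists L : R, 0 <= L /\ forall u v (h : R),
    (forall j, `|u j - v j| <= h) -> `|G u i - G v i| <= L * h.
  by move=> i; have [M' [L [? ? ? ?]]] := Gl i; exists L.
have le_sum (w : I -> R) i : (forall j, 0 <= w j) -> w i <= \sum_j w j.
  by move=> w0; rewrite (bigD1 i)//= lerDl; apply: sumr_ge0 => j _.
(* Summing over the finite index type makes the constants uniform; the added 1 makes the Lipschitz
   constant strictly positive. *)
apply: (@picard R I G x0 (\sum_j M j) (1 + \sum_j L j)).
- by apply: sumr_ge0 => j _; case: (HM j).
- by rewrite ltr_pwDl//; apply: sumr_ge0 => j _; case: (HL j).
- move=> u i; have [_ /(_ u)/le_trans] := HM i; apply.
  by apply: le_sum => j; case: (HM j).
- move=> u v i h uv; have h0 : 0 <= h by apply: le_trans (uv i).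
  have [_ /(_ u v h uv)/le_trans] := HL i; apply; rewrite ler_wpM2r//.
  apply: le_trans (le_sum L i _) _; first by move=> j; case: (HL j).
  by rewrite lerDr.
Qed.

(** * The Lyapunov function along curves in the state space *)

Section LyapunovAlongCurve.
Context (R : realType) (n : nat) (i0 : 'I_n).
Variables (w : 'I_n -> R) (e : R) (r : R -> 'I_n -> R) (y : R -> R).

Lemma is_derive_lyap (t : R) (r' : 'I_n -> R) (y' : R) :
  (forall i, is_derive t 1 (r^~ i) (r' i)) -> is_derive t 1 y y' ->
  is_derive t 1 (fun s => lyap i0 w e (r s) (y s)) (dlyap i0 w e (r t) (y t) r' y').
Proof.
move=> dr dy.
have H1 : is_derive t 1 (fun s => y s ^+ 2 / 2) (y t * y').
  have -> : (fun s => y s ^+ 2 / 2) = 2^-1 \*: (y * y).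
    by apply/funext => s; change (y s ^+ 2 / 2 = 2^-1 * (y s * y s)); ring.
  by apply: is_derive_eq; rewrite /GRing.scale/=; field.
have H2 : is_derive t 1 (fun s => \sum_i w i * r s i ^+ 2 / 2)
    (\sum_i w i * (r t i * r' i)).
  have -> : (fun s => \sum_i w i * r s i ^+ 2 / 2) =
      \sum_i (w i / 2) \*: (r^~ i * r^~ i).
    rewrite fct_sumE; apply/funext => s; apply: eq_bigr => i _.
    by change (w i * r s i ^+ 2 / 2 = w i / 2 * (r s i * r s i)); ring.
  have -> : \sum_i w i * (r t i * r' i) =
      \sum_i (w i / 2) *: (r t i *: r' i + r t i *: r' i).
    by apply: eq_bigr => i _; rewrite /GRing.scale/=; field.
  by apply: is_derive_sum => i; exact: is_deriveZ (is_deriveM (dr i) (dr i)).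
have H3 : is_derive t 1 (fun s => e * (y s * r s i0))
    (e * (y' * r t i0 + y t * r' i0)).
  have := is_deriveZ e (is_deriveM dy (dr i0)).
  by move=> /is_derive_eq; apply; rewrite /GRing.scale/=; ring.
exact: is_deriveD (is_deriveD H1 H2) H3.
Qed.

Lemma cvg_lyap (F : set_system R) (FF : Filter F) (t : R) :
  (forall i, r^~ i @ F --> r t i) -> y @ F --> y t ->
  lyap i0 w e (r s) (y s) @[s --> F] --> lyap i0 w e (r t) (y t).
Proof.
move=> cr cy; rewrite /lyap; apply: cvgD; first apply: cvgD.
- by apply: cvgM; [exact: cvgM|exact: cvg_cst].
- apply: cvg_big => [|i _]; first exact: add_continuous.
  by apply: cvgM; [apply: cvgM; [exact: cvg_cst|exact: cvgM]|exact: cvg_cst].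
- by apply: cvgM; [exact: cvg_cst|exact: cvgM].
Qed.
End LyapunovAlongCurve.

(** * The sup norm of a state and its coordinates *)

Section StateNorm.
Context (R : realType) (n : nat).
Implicit Types x : 'rV[R]_n * R.

Lemma state_norm_fst x i : `|x.1 0 i| <= `|x|.
Proof.
have /le_trans -> // : `|x.1 0 i| <= `|x.1|; last by rewrite [leRHS]/Num.norm/= le_max lexx.
by rewrite [leRHS]/Num.norm/= mx_normrE; exact: (le_bigmax _ (fun ij => `|x.1 ij.1 ij.2|) (0, i)).
Qed.

Lemma state_norm_snd x : `|x.2| <= `|x|.
Proof. by rewrite [leRHS]/Num.norm/= le_max lexx orbT. Qed.

Lemma state_norm_le x (h : R) : 0 <= h -> (forall i, `|x.1 0 i| <= h) -> `|x.2| <= h ->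
  `|x| <= h.
Proof.
move=> h0 h1 h2; rewrite [leLHS]/Num.norm/= ge_max h2 andbT.
rewrite [leLHS]/Num.norm/= mx_normrE; apply: bigmax_le => //= -[i j] _ /=.
by rewrite (ord1 i).
Qed.

Lemma state_norm_sqn x : `|x| ^+ 2 <= sqn (x.1 0) x.2.
Proof.
have q0 := sqn_ge0 (x.1 0) x.2.
rewrite -[leRHS]sqr_sqrtr// ler_sqr ?nnegrE ?sqrtr_ge0//.
have root (z : R) : z ^+ 2 <= sqn (x.1 0) x.2 -> `|z| <= Num.sqrt (sqn (x.1 0) x.2).
  by move=> zq; rewrite -sqrtr_sqr ler_sqrt.
apply: state_norm_le => [|i|]; rewrite ?sqrtr_ge0//; apply: root.
  exact: sqn_ge_r.
exact: sqn_ge_y.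
Qed.

Lemma sqn_state_norm x : sqn (x.1 0) x.2 <= (1 + n%:R) * `|x| ^+ 2.
Proof.
have sq (z : R) : `|z| <= `|x| -> z ^+ 2 <= `|x| ^+ 2.
  by move=> zx; rewrite -[z ^+ 2]real_normK ?num_real// ler_sqr ?nnegrE.
rewrite mulrDl mul1r; apply: lerD; first exact/sq/state_norm_snd.
have -> : n%:R * `|x| ^+ 2 = \sum_(i < n) `|x| ^+ 2.
  by rewrite sumr_const card_ord mulr_natl.
by apply: ler_sum => i _; exact/sq/state_norm_fst.
Qed.

Lemma cvg_state_fst (T : Type) (F : set_system T) (FF : Filter F)
    (x : T -> 'rV[R]_n * R) (l : 'rV[R]_n * R) i :
  x @ F --> l -> (x u).1 0 i @[u --> F] --> l.1 0 i.
Proof.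
move=> /cvgrPdist_le xl; apply/cvgrPdist_le => e /xl; apply: filterS => u.
by apply: le_trans; have := state_norm_fst (l - x u) i; rewrite /= !mxE.
Qed.

Lemma cvg_state_snd (T : Type) (F : set_system T) (FF : Filter F)
    (x : T -> 'rV[R]_n * R) (l : 'rV[R]_n * R) :
  x @ F --> l -> (x u).2 @[u --> F] --> l.2.
Proof.
move=> /cvgrPdist_le xl; apply/cvgrPdist_le => e /xl; apply: filterS => u.
by apply: le_trans; exact: (state_norm_snd (l - x u)).
Qed.

Lemma linear_approx_fst A (x : R -> 'rV[R]_n * R) t l i :
  linear_approx A x t l -> linear_approx A (fun s => (x s).1 0 i) t (l.1 0 i).
Proof.
move=> H h /H; apply: filterS => s + As => /(_ As); apply: le_trans.
have := state_norm_fst (x s - x t - (s - t) *: l) i.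
by rewrite /= !mxE.
Qed.

Lemma linear_approx_snd A (x : R -> 'rV[R]_n * R) t l :
  linear_approx A x t l -> linear_approx A (fun s => (x s).2) t l.2.
Proof.
move=> H h /H; apply: filterS => s + As => /(_ As); apply: le_trans.
exact: (state_norm_snd (x s - x t - (s - t) *: l)).
Qed.

Lemma linear_approx_state A (r : R -> 'I_n -> R) (y : R -> R) t r' y' :
  (forall i, linear_approx A (r^~ i) t (r' i)) -> linear_approx A y t y' ->
  linear_approx A (fun s => (\row_i r s i, y s)) t (\row_i r' i, y').
Proof.
move=> Hr Hy h h0; have Hrs : \forall s \near t, forall i, A s ->
    `|r s i - r t i - (s - t) *: r' i| <= h * `|s - t|.
  exact: (filter_forall (nbhs_filter t) (fun i => Hr i h h0)).
apply: filterS2 (Hy h h0) Hrs => s Hs {}Hrs As.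
apply: state_norm_le => [|i|].
- by rewrite mulr_ge0// ltW.
- by rewrite /= !mxE; exact: Hrs.
- exact: Hs.
Qed.

End StateNorm.

(** * Lyapunov's stability theorem *)

Section LyapunovStability.
Context (R : realType) (V : normedModType R).
Variables (D : set V) (F G : V -> V) (xs : V).
Variables (W : V -> R) (dW : V -> V -> R) (k C rho : R).
Hypotheses (k0 : 0 < k) (C0 : 0 < C) (rho0 : 0 < rho).
Hypothesis fixed_xs : fixed_point D F xs.
Hypothesis W_bounds : forall x, k * `|x - xs| ^+ 2 <= W x <= C * `|x - xs| ^+ 2.
(** Regularity of [W] is asked along curves, in the two forms used: continuity relative to a time
    interval, which covers the endpoint 0, and the chain rule at interior times. *)
Hypothesis W_continuous : forall (A : set R) (x : R -> V) (t : R),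
  x @ within A (nbhs t) --> x t -> W \o x @ within A (nbhs t) --> W (x t).
Hypothesis W_derive : forall (x : R -> V) (t : R) l,
  linear_approx setT x t l -> is_derive t 1 (W \o x) (dW (x t) l).
Hypothesis W_decreases : forall x, `|x - xs| < rho -> dW x (F x) <= - k * W x.
Hypothesis ball_D : forall x, `|x - xs| < rho -> D x.
(* [G] is a globally well behaved modification of [F] away from [xs]. *)
Hypothesis G_F : forall x, `|x - xs| < rho -> G x = F x.
Hypothesis G_solution : forall x0, exists2 x : R -> V, x 0 = x0 &
  forall t, 0 <= t -> linear_approx setT x t (G (x t)).

Let W_ge x : k * `|x - xs| ^+ 2 <= W x.
Proof. by have /andP[] := W_bounds x. Qed.

Let W_lt_dist x h : 0 <= h -> W x < k * h ^+ 2 -> `|x - xs| < h.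
Proof.
move=> h0; have /andP[/le_lt_trans H _] := W_bounds x => /H.
by rewrite ltr_pM2l// ltr_sqr ?nnegrE.
Qed.

(** The sublevel k h^2 of [W] lies in the ball of radius h <= rho, where H equals F and [W]
    decreases. A general H covers the solutions of F as well as those of G. *)
Let trapped (H : V -> V) (x : R -> V) (T h : R) :
  (forall z, `|z - xs| < rho -> H z = F z) -> 0 < h <= rho ->
  (forall t, 0 <= t < T -> linear_approx `[0, T[ x t (H (x t))) ->
  W (x 0) < k * h ^+ 2 -> forall t, 0 <= t < T ->
  `|x t - xs| < h /\ W (x t) * (1 + k * t) <= W (x 0).
Proof.
move=> HF /andP[h0 hrho] xH W0 t tT.
have [||||||Wt Wd] := @trapping R (W \o x) (fun t => dW (x t) (H (x t))) k
  (k * h ^+ 2) T _ _ _ _ _ _ t tT => //; try exact: ltW.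
- by move=> s sT; apply: W_continuous; apply: linear_approx_cvg (xH s sT).
- move=> s /andP[s0 sT]; apply: W_derive.
  apply: linear_approx_nbhs (xH s _); last by rewrite ltW.
  have : \forall u \near s, 0 < u /\ u < T.
    by apply: filterI; [exact: lt_nbhsr|exact: lt_nbhsl].
  by apply: filterS => u [u0 uT]; rewrite /= in_itv/= uT ltW.
- move=> s _; apply: le_trans (W_ge _).
  by rewrite mulr_ge0 ?sqr_ge0// ltW.
- move=> s sT /= Ws; have xsh := W_lt_dist (ltW h0) Ws.
  have xsr := lt_le_trans xsh hrho.
  by rewrite HF// W_decreases.
by split=> //; exact: W_lt_dist (ltW h0) Wt.
Qed.

Let radius h : 0 < h -> exists2 delta, 0 < delta &
  forall x, `|x - xs| < delta -> W x < k * h ^+ 2.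
Proof.
move=> h0; have kC0 : 0 < k / C by rewrite divr_gt0.
exists (h * Num.sqrt (k / C)); first by rewrite mulr_gt0// sqrtr_gt0.
move=> x xd; have /andP[_ /le_lt_trans] := W_bounds x; apply.
have -> : k * h ^+ 2 = C * (h * Num.sqrt (k / C)) ^+ 2.
  by rewrite exprMn sqr_sqrtr ?ltW//; field; rewrite gt_eqF.
by rewrite ltr_pM2l// ltr_sqr ?nnegrE// mulr_ge0 ?sqrtr_ge0// ltW.
Qed.

Lemma lyapunov_stability : locally_asymptotically_stable D F xs.
Proof.
split=> //.
- move=> eps eps0; pose h := Num.min rho eps.
  have hrho : h <= rho by rewrite ge_min lexx.
  have heps : h <= eps by rewrite ge_min lexx orbT.
  have h0 : 0 < h by rewrite lt_min rho0.
  have hh : 0 < h <= rho by rewrite h0.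
  have [delta delta0 Wd] := radius h0.
  exists delta => // x0 _ /Wd Wx0; split; last first.
    move=> T x T0 xx0 xsol t tT; apply: lt_le_trans heps.
    have [] := @trapped F x T h _ hh _ _ t tT => //; last by rewrite xx0.
    by move=> s sT; apply/has_derive_withinP; have [] := xsol s; rewrite //= in_itv.
  have [x xx0 xG] := G_solution x0; exists x => // t; rewrite /= in_itv/= andbT => t0.
  (* A solution of G that starts close enough never leaves the ball where G equals F, hence solves
     the original system. Time t + 1 only serves to place t inside a half-open interval. *)
  have xt : `|x t - xs| < rho.
    apply: lt_le_trans hrho.
    have tT : 0 <= t < t + 1 by rewrite t0 ltrDl ltr01.
    have xG' s : 0 <= s < t + 1 -> linear_approx `[0, t + 1[ x s (G (x s)).
      by move=> /andP[s0 _]; exact: linear_approx_sub (@subsetT _ _) (xG s s0).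
    by have [] := trapped G_F hh xG' _ tT; rewrite ?xx0.
  split; first exact: ball_D.
  by apply/has_derive_withinP; rewrite -G_F//; exact: linear_approx_sub (@subsetT _ _) (xG t t0).
have [delta delta0 Wd] := radius rho0; exists delta => // x xsol /Wd Wx0.
have dec t : 0 <= t -> W (x t) * (1 + k * t) <= W (x 0).
  move=> t0; have tT : 0 <= t < t + 1 by rewrite t0 ltrDl ltr01.
  have rr : 0 < rho <= rho by rewrite rho0 lexx.
  have xF s : 0 <= s < t + 1 -> linear_approx `[0, t + 1[ x s (F (x s)).
    move=> /andP[s0 sT]; have [|_ /has_derive_withinP] := xsol s.
      by rewrite /= in_itv/= s0.
    by apply: linear_approx_sub => u; rewrite /= !in_itv/= => /andP[->].
  by have [] := trapped (fun z _ => erefl (F z)) rr xF Wx0 tT.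
apply/cvgrPdist_lt => eps eps0; near=> t.
rewrite distrC ltNge; apply/negP => xt.
have t0 : 0 <= t by near: t; exact: nbhs_pinfty_ge.
(* From this time on k t (k eps^2) >= W (x 0), so W (x t) >= k eps^2 would contradict the decay of
   (1 + k t) W. *)
have tM : W (x 0) / (k * k * eps ^+ 2) <= t.
  by near: t; apply: nbhs_pinfty_ge; rewrite num_real.
have kt0 : 0 <= k * t by rewrite mulr_ge0// ltW.
have ke0 : 0 < k * eps ^+ 2 by rewrite mulr_gt0// exprn_gt0.
move: tM; rewrite ler_pdivrMr; last by rewrite -mulrA mulr_gt0.
have : k * eps ^+ 2 <= W (x t).
  apply: le_trans (W_ge _).
  by rewrite ler_pM2l// ler_sqr ?nnegrE// ltW.
have := dec t t0; nra.
Unshelve. all: by end_near. Qed.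

End LyapunovStability.

(** * The model near its fixed point *)

Section LocalModel.
Context (R : realType) (n : nat) (i0 : 'I_n).
Variables (K : 'I_n -> R) (f : 'I_n -> R -> R) (p al mu : R -> R) (qs c L : R).
Variable d : 'I_n -> R.
Let s (i : 'I_n) : R := K i / (f i (p qs) + al qs).
Let xs := fixed_state K f p al qs.
Let F := vector_field K f p al mu.
Hypotheses (K0 : forall i, 0 < K i) (al0 : 0 < al qs) (qs0 : 0 < qs).
Hypotheses (c0 : 0 <= c) (d0 : forall i, 0 <= d i) (d00 : 0 < d i0) (L0 : 0 <= L).
Hypothesis f0 : forall i, 0 <= f i (p qs).
Hypothesis al_derive : is_derive qs 1 al (- c).
Hypothesis f_derive : forall i, is_derive qs 1 (f i \o p) (d i).
Hypothesis equilibrium : al qs * (\sum_i s i) = mu qs.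
Hypothesis mu_slope : forall q q', exists2 m, 0 <= m <= L & mu q - mu q' = m * (q - q').
Hypothesis al_lipschitz : exists2 r, 0 < r & exists2 l, 0 <= l &
  forall u v, `|u - qs| <= r -> `|v - qs| <= r -> `|al u - al v| <= l * `|u - v|.
Hypothesis f_lipschitz : forall i, exists2 r, 0 < r & exists2 l, 0 <= l &
  forall u v, `|u - qs| <= r -> `|v - qs| <= r ->
    `|f i (p u) - f i (p v)| <= l * `|u - v|.

Let b (i : 'I_n) : R := f i (p qs) + al qs.

Let b0 i : 0 < b i.
Proof. by rewrite ltr_wpDl. Qed.

Let s0 i : 0 < s i.
Proof. exact: divr_gt0 (K0 i) (b0 i). Qed.

Let near_value (phi : R -> R) (l h : R) : is_derive qs 1 phi l -> 0 < h ->
  \forall q \near qs, `|phi q - phi qs| <= h.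
Proof.
move=> [dphi _] h0.
have : {for qs, continuous phi}.
  by apply: differentiable_continuous; apply/derivable1_diffP.
move=> /cvgrPdist_le /(_ h h0); apply: filterS => q.
by rewrite distrC.
Qed.

(** Substituting K_i = b_i s_i and mu(q^s) = alpha(q^s) sum s_i, and writing every increment as
    slope times q - q^s, turns the field into a member of the perturbed linear family. *)
Lemma lyapunov_near_equilibrium : exists (w : 'I_n -> R) (e k C : R),
  [/\ 0 < k, 0 < C,
   (forall r y, k * sqn r y <= lyap i0 w e r y <= C * sqn r y) &
   \forall q \near qs, forall r : 'I_n -> R,
    dlyap i0 w e r (q - qs)
      (fun i => K i - f i (p q) * (s i + r i) - al q * (s i + r i))
      (al q * (\sum_i (s i + r i)) - mu q) <= - k * lyap i0 w e r (q - qs)].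
Proof.
have hb i : al qs <= b i by rewrite lerDr.
have [w [e [k [C [h [k0 C0 h0 hW hdW]]]]]] :=
  lyapunov_perturbed al0 c0 L0 hb d0 d00 s0.
exists w, e, k, C; split=> //.
(* Half of h, because f_i o p and alpha both contribute to the change of b_i. *)
have h20 : 0 < h / 2 by rewrite divr_gt0.
have near_f : \forall q \near qs, forall i, `|(f i \o p) q - (f i \o p) qs| <= h / 2.
  exact: (filter_forall (nbhs_filter qs) (fun i => near_value (f_derive i) h20)).
have near_d : \forall q \near qs, forall i, exists2 d', `|d' - d i| <= h &
    (f i \o p) q - (f i \o p) qs = d' * (q - qs).
  exact: (filter_forall (nbhs_filter qs) (fun i => is_derive_slope (f_derive i) h0)).
near=> q => r.
have alq : `|al q - al qs| <= h / 2 by near: q; exact: near_value al_derive h20.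
have [c' cc' alc] : exists2 c', `|c' - - c| <= h & al q - al qs = c' * (q - qs).
  by near: q; exact: is_derive_slope.
have fq : forall i, `|(f i \o p) q - (f i \o p) qs| <= h / 2 by near: q.
have /choice[d' Hd'] : forall i, exists d', `|d' - d i| <= h /\
    (f i \o p) q - (f i \o p) qs = d' * (q - qs).
  have dq : forall i, exists2 d', `|d' - d i| <= h &
    (f i \o p) q - (f i \o p) qs = d' * (q - qs) by near: q.
  by move=> i; have [d' ? ?] := dq i; exists d'.
have [m mL muq] := mu_slope q qs.
have hal : `|al q - al qs| <= h by lra.
have hc : `|- c' - c| <= h by rewrite -opprB normrN opprK addrC -[c]opprK.
have hb' i : `|(f i (p q) + al q) - b i| <= h.
  have := ler_normD (f i (p q) - f i (p qs)) (al q - al qs).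
  rewrite /b (_ : _ - _ + _ = f i (p q) + al q - (f i (p qs) + al qs)); last by ring.
  by have /= := fq i; lra.
have hd' i : `|d' i - d i| <= h by case: (Hd' i).
have := hdW (al q) (- c') (fun i => f i (p q) + al q) d' m r (q - qs) mL hal hc hb' hd'.
congr (dlyap _ _ _ _ _ _ _ <= _).
  apply/funext => i; have [_ /=] := Hd' i => Hf.
  have Ks : K i = b i * s i by rewrite /s -/(b i) mulrC divfK// gt_eqF.
  rewrite Ks /b.
  have -> : - (f i (p q) + al q) * r i - (d' i - - c') * s i * (q - qs) =
    - (f i (p q) + al q) * r i - s i * (d' i * (q - qs) + c' * (q - qs)) by ring.
  by rewrite -Hf -alc; ring.
rewrite big_split/=.
have -> : - c' * (\sum_i s i) * (q - qs) = - ((\sum_i s i) * (c' * (q - qs))) by ring.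
by rewrite -muq -alc -equilibrium; ring.
Unshelve. all: by end_near. Qed.

Lemma local_asymptotic_stability :
  locally_asymptotically_stable (state_space (n := n)) F xs.
Proof.
have [w [e [k [C [k0 C0 hW hdW]]]]] := lyapunov_near_equilibrium.
have [ra ra0 [la la0 Hal]] := al_lipschitz.
have /choice[rf Hrf] : forall i, exists r : R, 0 < r /\ exists2 l, 0 <= l &
    forall u v, `|u - qs| <= r -> `|v - qs| <= r ->
      `|f i (p u) - f i (p v)| <= l * `|u - v|.
  by move=> i; have [r r0 H] := f_lipschitz i; exists r.
have [rs rs0 rss] := fin_pos_lower_bound s0.
have [rf' rf'0 rff] := fin_pos_lower_bound (fun i => proj1 (Hrf i)).
have /nbhs_ballP[rd /= rd0 Hrd] := hdW.
(* The bounds by q^s and s_i keep the ball inside the state space, rd keeps it where [W] decreases,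
   and ra and rf keep it where alpha and f_i o p are Lipschitz. *)
have [rho [rho0 rhoqs rhos rhod [rhoa rhof]]] : exists rho : R,
  [/\ 0 < rho, rho <= qs, forall i, rho <= s i, rho <= rd &
    rho <= ra /\ forall i, rho <= rf i].
  exists (Num.min qs (Num.min rs (Num.min rd (Num.min ra rf')))); split.
  - by rewrite !lt_min qs0 rs0 rd0 ra0.
  - by rewrite ge_min lexx.
  - by move=> i; apply: le_trans (rss i); rewrite !ge_min lexx ?orbT.
  - by rewrite !ge_min lexx ?orbT.
  - split; first by rewrite !ge_min lexx ?orbT.
    by move=> i; apply: le_trans (rff i); rewrite !ge_min lexx ?orbT.
have xs1 i : xs.1 0 i = s i by rewrite mxE.
pose cr i := clamp (s i - rho) (s i + rho).
pose cq := clamp (qs - rho) (qs + rho).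
have le_rho (z : R) : z - rho <= z + rho by lra.
(* The clamping box is the closed sup-norm ball of radius rho, so nothing changes within distance
   rho of the fixed point. *)
pose G (x : 'rV[R]_n * R) := F (\row_i cr i (x.1 0 i), cq x.2).
have coord x i : `|x - xs| < rho -> `|x.1 0 i - s i| < rho.
  by move=> xr; apply: le_lt_trans xr; have := state_norm_fst (x - xs) i; rewrite /= !mxE.
have coordq (x : 'rV[R]_n * R) : `|x - xs| < rho -> `|x.2 - qs| < rho.
  by move=> xr; apply: le_lt_trans xr; exact: (state_norm_snd (x - xs)).
have within (z u : R) : `|u - z| < rho -> z - rho <= u <= z + rho.
  by rewrite ltr_norml; lra.
have within' (u : R) : qs - rho <= u <= qs + rho -> `|u - qs| <= rho.
  by rewrite ler_norml; lra.
have bl_cr i : bounded_lipschitz (fun u : option 'I_n -> R => cr i (u (Some i))).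
  by apply: (@bounded_lipschitz_clamp _ _ _ _ 1 id) => // x y _ _; rewrite mul1r.
have bl_al : bounded_lipschitz (fun u : option 'I_n -> R => al (cq (u None))).
  apply: (@bounded_lipschitz_clamp _ _ _ _ la) => // x y /within' hx /within' hy.
  by apply: Hal; apply: le_trans rhoa.
have bl_f i : bounded_lipschitz (fun u : option 'I_n -> R => f i (p (cq (u None)))).
  have [_ [l l0 Hf]] := Hrf i.
  apply: (@bounded_lipschitz_clamp _ _ _ _ l (f i \o p)) => // x y /within' hx /within' hy.
  by apply: Hf; apply: le_trans (rhof i).
have bl_mu : bounded_lipschitz (fun u : option 'I_n -> R => mu (cq (u None))).
  apply: (@bounded_lipschitz_clamp _ _ _ _ L) => // x y _ _.
  have [m /andP[m0 mL] ->] := mu_slope x y.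
  by rewrite normrM ler_wpM2r// ger0_norm.
(* The existence theorem speaks of families of reals: [Some i] indexes R_i and [None] indexes q. *)
pose state (u : option 'I_n -> R) : 'rV[R]_n * R := (\row_i u (Some i), u None).
pose Gu u o := if o is Some i then (G (state u)).1 0 i else (G (state u)).2.
have bl_Gu o : bounded_lipschitz (Gu^~ o).
  case: o => [i|].
    have -> : Gu^~ (Some i) = fun u => K i - f i (p (cq (u None))) * cr i (u (Some i))
        - al (cq (u None)) * cr i (u (Some i)).
      by apply/funext => u; rewrite /Gu /G /F /vector_field /= !mxE.
    apply: bounded_lipschitzB; last exact: bounded_lipschitzM.
    by apply: bounded_lipschitzB; [exact: bounded_lipschitz_cst|exact: bounded_lipschitzM].
  have -> : Gu^~ None = fun u => al (cq (u None)) * (\sum_i cr i (u (Some i))) - mu (cq (u None)).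
    apply/funext => u; rewrite /Gu /G /F /vector_field /=; congr (_ * _ - _).
    by apply: eq_bigr => i _; rewrite !mxE.
  apply: bounded_lipschitzB => //; apply: bounded_lipschitzM => //.
  exact: bounded_lipschitz_sum.
pose W (x : 'rV[R]_n * R) := lyap i0 w e (fun i => x.1 0 i - s i) (x.2 - qs).
pose dW (x l : 'rV[R]_n * R) :=
  dlyap i0 w e (fun i => x.1 0 i - s i) (x.2 - qs) (l.1 0) l.2.
have dev (x : 'rV[R]_n * R) : (fun i => x.1 0 i - s i) = (x - xs).1 0.
  by apply/funext => i; rewrite /= !mxE.
have nC : 0 < C * (1 + n%:R) by rewrite mulr_gt0// ltr_pwDl.
apply: (@lyapunov_stability R _ _ F G xs W dW k (C * (1 + n%:R)) rho) => //.
- split; first split.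
  + by move=> i; rewrite xs1 ltW.
  + exact: ltW.
  + rewrite /F /vector_field /=; congr pair.
      apply/rowP => i; rewrite !mxE -/(s i) -addrA -opprD -mulrDl.
      by rewrite -/(b i) /s -/(b i) mulrC divfK ?subrr// gt_eqF.
    rewrite -equilibrium (eq_bigr s) ?subrr// => i _; exact: xs1.
- move=> x; have /andP[h1 h2] := hW (fun i => x.1 0 i - s i) (x.2 - qs).
  apply/andP; split.
    apply: le_trans h1; rewrite ler_pM2l// dev; exact: (state_norm_sqn (x - xs)).
  apply: le_trans h2 _; rewrite -mulrA ler_pM2l// dev; exact: (sqn_state_norm (x - xs)).
- move=> A x t xt; apply: (@cvg_lyap _ _ _ _ _ (fun u i => (x u).1 0 i - s i) (fun u => (x u).2 - qs)).
    by move=> i; apply: cvgB; [exact: (cvg_state_fst (i := i) _ xt)|exact: cvg_cst].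
  by apply: cvgB; [exact: (cvg_state_snd _ xt)|exact: cvg_cst].
- move=> x t l xl.
  apply: (@is_derive_lyap _ _ _ _ _ (fun u i => (x u).1 0 i - s i) (fun u => (x u).2 - qs)).
    move=> i; have /is_deriveP H := linear_approx_fst i xl.
    by apply: is_derive_eq; rewrite subr0.
  have /is_deriveP H := linear_approx_snd xl.
  by apply: is_derive_eq; rewrite subr0.
- move=> x xr; have := Hrd x.2; rewrite /ball/= distrC => /(_ (lt_le_trans (coordq x xr) rhod)).
  move=> /(_ (fun i => x.1 0 i - s i)).
  rewrite /dW /W; congr (dlyap _ _ _ _ _ _ _ <= _).
    by apply/funext => i; rewrite /F /vector_field /= mxE [s i + _]addrC subrK.
  rewrite /F /vector_field /=; congr (_ * _ - _).
  by apply: eq_bigr => i _; rewrite [s i + _]addrC subrK.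
- move=> x xr; split=> [i|].
    have := coord x i xr; rewrite ltr_norml; have := rhos i; lra.
  by have := coordq x xr; rewrite ltr_norml; lra.
- move=> x xr; rewrite /G; congr F; rewrite [RHS]surjective_pairing; congr pair.
    by apply/rowP => i; rewrite mxE /cr clamp_id// within// coord.
  by rewrite /cq clamp_id// within// coordq.
- move=> x0; pose u0 o := if o is Some i then x0.1 0 i else x0.2.
  have [u [uu0 Hu]] := global_solution u0 bl_Gu.
  exists (state \o u).
    rewrite /= uu0 /state [RHS]surjective_pairing; congr pair.
    by apply/rowP => i; rewrite mxE.
  move=> t t0; rewrite /=.
  have -> : G (state (u t)) = (\row_i Gu (u t) (Some i), Gu (u t) None).
    rewrite [LHS]surjective_pairing; congr pair.
    by apply/rowP => i; rewrite mxE.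
  apply: (@linear_approx_state _ _ setT (fun t i => u t (Some i)) (fun t => u t None)).
    by move=> i; apply/is_deriveP; exact: Hu.
  by apply/is_deriveP; exact: Hu.
Qed.
End LocalModel.

(** * Service rate, price, and the stability theorem *)

(** Secant slopes of a piecewise linear function lie between the slopes of its pieces, here 0 and
    mustar / qc, even across the kink. *)
Lemma service_slope (R : realType) (mustar qc q q' : R) :
  0 < mustar -> 0 < qc -> exists2 m, 0 <= m <= mustar / qc &
  service mustar qc q - service mustar qc q' = m * (q - q').
Proof.
move=> mu0 qc0; pose k := mustar / qc.
have k0 : 0 < k by rewrite divr_gt0.
have kqc : mustar = k * qc by rewrite divfK// gt_eqF.
wlog qq : q q' / q' < q => [H|].
  have [|lt|->] := ltgtP q' q; first exact: H.
    have [m hm E] := H _ _ lt; exists m => //.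
    by rewrite -opprB E -mulrN opprB.
  by exists 0; rewrite ?lexx ?ltW// !subrr mulr0.
exists ((service mustar qc q - service mustar qc q') / (q - q')); last first.
  by rewrite divfK// gt_eqF// subr_gt0.
have d0 : 0 < q - q' by lra.
rewrite ler_pdivlMr// mul0r ler_pdivrMr// /service -/k.
by case: (leP q qc) => h1; case: (leP q' qc) => h2; rewrite ?kqc; nra.
Qed.

Lemma near_price_rising (R : realType) (beta qm q : R) : q < qm ->
  \forall u \near q, price beta qm u = beta * u.
Proof.
by move=> qqm; apply: filterS (lt_nbhsl qqm) => u uqm; rewrite /price ltW.
Qed.

Lemma near_price_falling (R : realType) (beta qm q : R) : qm < q < 2 * qm ->
  \forall u \near q, price beta qm u = beta * (2 * qm - u).
Proof.
move=> /andP[q1 q2]; apply: filterS2 (lt_nbhsr q1) (lt_nbhsl q2) => u u1 u2.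
by rewrite /price leNgt u1/= ltW.
Qed.

Lemma is_derive_price_rising (R : realType) (beta qm q : R) : q < qm ->
  is_derive q 1 (price beta qm) beta.
Proof.
move=> qqm; apply: (@near_eq_is_derive _ _ _ (beta \*: id)).
  by apply: filterS (near_price_rising beta qqm) => u ->.
by apply: is_derive_eq; rewrite /GRing.scale/= mulr1.
Qed.

Lemma is_derive_price_falling (R : realType) (beta qm q : R) : qm < q < 2 * qm ->
  is_derive q 1 (price beta qm) (- beta).
Proof.
move=> qq; apply: (@near_eq_is_derive _ _ _ (beta \*: (cst (2 * qm) - id))).
  by apply: filterS (near_price_falling beta qq) => u ->.
by apply: is_derive_eq; rewrite /GRing.scale/= sub0r mulrN mulr1.
Qed.

(** Derivability of p accompanies the sign of [derive1] because that operator has a value even where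
    no derivative exists. *)
Theorem theorem4p4 (R : realType) (n : nat) (hn : (1 <= n)%N)
  (K : 'I_n -> R) (mustar qc beta qm : R)
  (hK : forall i, 0 < K i) (hmustar : 0 < mustar) (hqc : 0 < qc)
  (hbeta : 0 < beta) (hqm : 0 < qm)
  (alpha : R -> R)
  (alpha_ge0 : forall q : R, 0 <= q -> 0 <= alpha q)
  (alpha_C1 : C1_nonneg alpha)
  (alpha_noninc : forall x y : R, 0 <= x -> x <= y -> alpha y <= alpha x)
  (alpha0_gt0 : 0 < alpha 0)
  (f : 'I_n -> R -> R)
  (f_ge0 : forall i (x : R), 0 <= x -> 0 <= f i x)
  (f_nondec : forall i (x y : R), 0 <= x -> x <= y -> f i x <= f i y)
  (f_C1 : forall i, C1_nonneg (f i))
  (f_pos_derive : exists i, forall x : R, 0 <= x ->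
     exists2 d : R, has_derive_within `[0, +oo[ (f i) x d & 0 < d)
  (qs qu : R) :
  let p := price beta qm in
  let mu := service mustar qc in
  let g := gfun K f p alpha mu in
  forall
  (hqs : 0 < qs < qm) (hqu : qm < qu < 2 * qm)
  (g_zeros : forall q : R, g_zero K f p alpha mu q <-> q = qs \/ q = qu)
  (g_sign_qs : changes_sign_at g qs)
  (g_sign_qu : changes_sign_at g qu)
  (g_derive_qu : is_derive qu 1 g (gfun' K f p alpha mu qu))
  (g_derive_qu_gt0 : 0 < gfun' K f p alpha mu qu),
  (forall z : R, g_zero K f p alpha mu z ->
     (derivable p z 1 /\ 0 < derive1 p z <-> z = qs)) /\
  locally_asymptotically_stable (state_space (n := n))
    (vector_field K f p alpha mu) (fixed_state K f p alpha qs).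
Proof.
move=> p mu g hqs hqu g_zeros _ _ _ _.
have [qs0 qsqm] := andP hqs.
have dps : is_derive qs 1 p beta by exact: is_derive_price_rising.
split.
  move=> z /g_zeros[->|->]; split => //.
  - by move=> _; rewrite derive1E; case: dps => ? ->.
  - have dpu : is_derive qu 1 p (- beta) by exact: is_derive_price_falling.
    by case: dpu => _ dpu [_]; rewrite derive1E dpu; lra.
  - by move=> E; move: hqu; rewrite E; lra.
have [_ alpha_qs gqs] := (g_zeros qs).2 (or_introl erefl).
have [i0 Hi0] := f_pos_derive.
have pqs : p qs = beta * qs by rewrite /p /price ltW.
(* Positivity makes p(q^s) an interior point of the half-line, where one-sided differentiability of
   f_i becomes two-sided. *)
have pqs0 : 0 < p qs by rewrite pqs mulr_gt0.
have [a' da] : exists a', is_derive qs 1 alpha a'.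
  by case: alpha_C1 => a' ? _; exists (a' qs); apply: has_derive_within_interior => //; auto using ltW.
have /choice[d Hd] : forall i, exists d, is_derive (p qs) 1 (f i) d.
  move=> i; case: (f_C1 i) => f' ? _; exists (f' (p qs)).
  by apply: has_derive_within_interior => //; auto using ltW.
have Hd0 i : 0 <= d i.
  apply: nondecreasing_is_derive_ge0 (Hd i) _.
  by near=> u => pu; apply: f_nondec => //; exact: ltW.
have Hdi0 : 0 < d i0.
  have [d' d'd d'0] := Hi0 _ (ltW pqs0).
  have dd' := has_derive_within_interior pqs0 d'd.
  by case: (Hd i0) => _ <-; case: dd' => _ ->.
(* By the chain rule with p'(q^s) = beta, the slope of f_i o p is d_i beta; c is minus the slope of
   alpha. *)
apply: (@local_asymptotic_stability R n i0 K f p alpha mu qs (- a') (mustar / qc)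
  (fun i => d i * beta)) => //.
- have dN := is_deriveN da.
  apply: nondecreasing_is_derive_ge0 dN _.
  near=> u => qsu; rewrite /GRing.opp/= lerN2; apply: alpha_noninc => //.
  exact: ltW.
- by move=> i; rewrite mulr_ge0// ltW.
- by rewrite mulr_gt0.
- by rewrite divr_ge0// ltW.
- by move=> i; apply: f_ge0; exact: ltW.
- by rewrite opprK.
- move: gqs; rewrite /gfun => /eqP; rewrite subr_eq0 => /eqP ->.
  by rewrite mulrC divfK// gt_eqF.
- by move=> q q'; exact: service_slope.
- exact: C1_nonneg_lipschitz.
- move=> i; have [r r0 [l l0 Hl]] := C1_nonneg_lipschitz (f_C1 i) pqs0.
  (* The first bound stays on the rising branch, where p is linear; the second keeps p u within r of
     p(q^s). *)
  exists (Num.min (qm - qs) (r / beta)).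
    by rewrite lt_min subr_gt0 qsqm divr_gt0.
  exists (l * beta); first by rewrite mulr_ge0// ltW.
  have pE u : `|u - qs| <= Num.min (qm - qs) (r / beta) ->
      p u = beta * u /\ `|p u - p qs| <= r.
    rewrite le_min ler_pdivlMr// => /andP[h1 h2].
    have pu : p u = beta * u.
      by rewrite /p /price ifT//; move: h1; rewrite ler_norml; lra.
    by split=> //; rewrite pu pqs -mulrBr normrM gtr0_norm// mulrC.
  move=> u v /pE[pu hu] /pE[pv hv]; apply: le_trans (Hl _ _ hu hv) _.
  by rewrite pu pv -mulrBr normrM gtr0_norm// mulrA.
Unshelve. all: by end_near. Qed.
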